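(* Let the initial density $\bar\rho$ and the initial velocity $w$ of a one-dimensional pressureless gas be real analytic functions with Taylor expansions at $x=0$ $$\bar\rho(x)=\sum_{k\ge 0}\rho_k\frac{x^k}{k!},\qquad\qquad w(x)=\omega_0-\omega_1x+\sum_{k\ge 3}\omega_k\frac{x^k}{k!},$$ where $$\rho_0>0,\qquad \omega_1>0,\qquad \omega_3>0 .$$ Set $t_0=1/\omega_1$. Then there exist $\delta>0$ and a local solution (in the sense described in the context) containing a point mass along an analytic curve $t\mapsto y(t)$, $t\in\,]t_0,t_0+\delta]$, with $y(t_0)=t_0\omega_0$. Moreover, the mass $m(t)$ concentrated at the point $y(t)$ has the form $$m(t)=\sqrt{t-t_0}\cdot\Upsilon(t),$$ where $\Upsilon$ is an analytic function with $\Upsilon(t_0)>0$.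
   Context: The one-dimensional pressureless gas equations are $$\partial_t\rho+\partial_x(\rho v)=0,\qquad \partial_t(\rho v)+\partial_x(\rho v^2)=0,\qquad \rho(0,x)=\bar\rho(x),\quad v(0,x)=w(x).$$ As long as the solution is smooth it is given by the method of characteristics: $v(t,x+tw(x))=w(x)$ and $\rho(t,x+tw(x))=\bar\rho(x)/(1+tw'(x))$. All statements are local, near $x=0$ and near the space-time point $(t_0,t_0\omega_0)$; $t_0=-1/w'(0)$ is the first time at which the singularity appears there. A local solution containing a point mass along the curve $t\mapsto y(t)$, $t\in\,]t_0,t_0+\delta]$, means the following. Up to time $t_0$ the solution is given by characteristics. For each $t\in\,]t_0,t_0+\delta]$ there are points $x_1(t)<x_2(t)$ near $0$ with $$x_1(t)+t\,w(x_1(t))=y(t)=x_2(t)+t\,w(x_2(t)),$$ such that particles initially located at points $x$ near $0$ with $x\notin[x_1(t),x_2(t)]$ still move freely (so that outside the point $y(t)$ the density and velocity are given by the characteristic formulas, with $1+tw'(x)>0$), while all particles initially located in $]x_1(t),x_2(t)[$ are concentrated in a point mass of size $m(t)$ located at $y(t)$ and moving with speed $\dot y(t)$. Conservation of mass and momentum is expressed by $$m(t)=\int_{x_1(t)}^{x_2(t)}\bar\rho(\xi)\,d\xi,\qquad m(t)\,\dot y(t)=\int_{x_1(t)}^{x_2(t)}\bar\rho(\xi)\,w(\xi)\,d\xi .$$ *)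

(* Defs.v *)
From Stdlib Require Import Reals Factorial.
From Coquelicot Require Import Coquelicot.

Open Scope R_scope.

Definition expansion_at (f : R -> R) (a : R) (c : nat -> R) : Prop :=
  locally a (fun x => is_pseries c (x - a) (f x)).

Definition analytic_at (f : R -> R) (a : R) : Prop :=
  exists c : nat -> R, expansion_at f a c.

(** Two-sided analyticity at every point, endpoints included: on [[a, b]], [f]
    is the restriction of a function analytic on an open neighbourhood. *)
Definition analytic_on (f : R -> R) (a b : R) : Prop :=
  forall t : R, a <= t <= b -> analytic_at f t.

Definition density_coef (rho_ : nat -> R) (k : nat) : R :=
  rho_ k / INR (fact k).

(** Note the sign convention for [om 1]; [om 2] does not occur. *)
Definition velocity_coef (om : nat -> R) (k : nat) : R :=
  match k with
  | 0%nat => om 0%nat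
  | 1%nat => - om 1%nat
  | 2%nat => 0
  | _ => om k / INR (fact k)
  end.

Definition on_characteristic (rhobar w : R -> R) (rho v : R -> R -> R)
    (t x : R) : Prop :=
  0 < 1 + t * Derive w x /\
  v t (x + t * w x) = w x /\
  rho t (x + t * w x) = rhobar x / (1 + t * Derive w x).

(** Arguments of [rho] and [v] are time, then position, whereas [x] ranges over
    initial positions in the neighbourhood [|x| < r] of [0]. The fields are
    constrained only on the region filled by the particles with [|x| < r]. As
    [v] is single-valued and a free particle at [z] with velocity [v t z] started
    at [z - t * v t z], two free particles never share a position. *)
Record point_mass_solution (rhobar w : R -> R) (t0 delta r : R)
    (rho v : R -> R -> R) (x1 x2 y m : R -> R) : Prop := {
  (** At [t = t0] the density is singular on the characteristic from [0]. *)
  pms_before : forall t x : R, 0 <= t <= t0 -> Rabs x < r ->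
    t < t0 \/ x <> 0 ->
    on_characteristic rhobar w rho v t x;
  pms_ends : forall t : R, t0 < t <= t0 + delta ->
    - r < x1 t /\ x1 t < x2 t /\ x2 t < r;
  pms_left : forall t : R, t0 < t <= t0 + delta ->
    x1 t + t * w (x1 t) = y t;
  pms_right : forall t : R, t0 < t <= t0 + delta ->
    x2 t + t * w (x2 t) = y t;
  pms_free : forall t x : R, t0 < t <= t0 + delta -> Rabs x < r ->
    x < x1 t \/ x2 t < x ->
    on_characteristic rhobar w rho v t x;
  (** A particle that is free at time [t] was never absorbed before [t]. *)
  pms_still_free : forall s t x : R, t0 < s <= t -> t <= t0 + delta ->
    Rabs x < r ->
    x < x1 t \/ x2 t < x -> x < x1 s \/ x2 s < x;
  pms_speed : forall t : R, t0 < t <= t0 + delta ->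
    ex_derive y t /\ v t (y t) = Derive y t;
  pms_mass : forall t : R, t0 < t <= t0 + delta ->
    is_RInt rhobar (x1 t) (x2 t) (m t);
  pms_momentum : forall t : R, t0 < t <= t0 + delta ->
    is_RInt (fun xi : R => rhobar xi * w xi) (x1 t) (x2 t)
      (m t * Derive y t)
}.

(* Main.v *)
Require Import Defs.
From Stdlib Require Import Reals Lra Lia Psatz ClassicalEpsilon.
From Coquelicot Require Import Coquelicot.
Open Scope R_scope.

(** Since [y] is the common value of [x + t w(x)] at the two ends, integrating the momentum
    equation gives the algebraic condition that [y] be the center of mass,
    [int rhobar(xi) (xi + t w(xi) - y) dxi = 0] over [[x1, x2]]. Write [x1 = c - s],
    [x2 = c + s], [q = s^2] and [u = t - t0]. Equality of the end positions is an analytic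
    relation between [c], [q], [u] that determines [q = (om1^2 / w3) u + ...], where
    [w3 = om3 / 6]. The center of mass condition, divided by [s^3], is an analytic relation
    between [c] and [q] with invertible linear part in [c]. The resulting system is solved
    for power series [c(u)], [q(u)], and then [y = t (om0 + A - B c)] where
    [A + s B = what(c + s)] and [what] is [w] without its affine part. Finally
    [m = 2 s M(u)] with [M] analytic, and [s = sqrt u * sqrt (q / u)]. *)

(** * Absolutely summable double sequences *)

(** The ends [c - s] and [c + s] are analytic in [sqrt u] only, and changing the sign of the root
    exchanges them; hence the symmetric quantities [c] and [q] are the ones that can be power series
    in [u]. The obstacle is that both equations degenerate at [u = 0], where the interval shrinks to
    a point. The factor [s ^ 3] has a reason: [xi + t w(xi) - y] vanishes at both ends, so it
    carries a factor [(xi - c) ^ 2 - q], and the interval has length [2 s]. Dividing by it must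
    leave a series in [c] and [q], so the quotients are built by recursion on powers and never by
    dividing functions. Afterwards [c] counts with weight 1 and [q] with weight 2; this weight
    governs the vanishing orders, the truncation indices and the sizes, of order [eta] and
    [eta ^ 2], of the ball in which the system is solved. Solvability rests on the coefficients
    [-2 * d0 * w3] of [c] and [w3] of [q] being nonzero, that is, on the positive density and on
    [om3 > 0]. *)

Definition abs_bound (x : nat -> R) (M : R) : Prop :=
  forall N, sum_f_R0 (fun k => Rabs (x k)) N <= M.

Lemma abs_bound_pos x M : abs_bound x M -> 0 <= M.
Proof.
  intros H; apply Rle_trans with (2 := H 0%nat); simpl; apply Rabs_pos.
Qed.

Lemma abs_bound_ex x M : abs_bound x M -> ex_series (fun k => Rabs (x k)).
Proof.
  intros H.
  destruct (ex_finite_lim_seq_incr (sum_n (fun k => Rabs (x k))) M) as [l Hl].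
  - intros n. rewrite sum_Sn. unfold plus; simpl. pose proof (Rabs_pos (x (S n))); lra.
  - intros n. rewrite sum_n_Reals. apply H.
  - exists l. exact Hl.
Qed.

Lemma Series_le_bound x l M :
  is_series x l -> (forall N, sum_f_R0 x N <= M) -> l <= M.
Proof.
  intros Hl H.
  change (Rbar_le l M).
  apply is_lim_seq_le with (u := sum_n x) (v := fun _ => M).
  - intros n; rewrite sum_n_Reals; apply H.
  - exact Hl.
  - apply is_lim_seq_const.
Qed.

Lemma abs_bound_Series_Rabs x M :
  abs_bound x M -> Series (fun k => Rabs (x k)) <= M.
Proof.
  intros H. apply Series_le_bound with (2 := H).
  apply Series_correct, (abs_bound_ex _ _ H).
Qed.

Lemma abs_bound_Series x M : abs_bound x M -> Rabs (Series x) <= M.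
Proof.
  intros H. apply Rle_trans with (1 := Series_Rabs _ (abs_bound_ex _ _ H)).
  now apply abs_bound_Series_Rabs.
Qed.

Lemma sum_f_R0_le_Series x N :
  (forall k, 0 <= x k) -> ex_series x -> sum_f_R0 x N <= Series x.
Proof.
  intros Hp Hx.
  rewrite (Series_incr_n x (S N)) by (try lia; assumption). simpl.
  enough (0 <= Series (fun k => x (S (N + k)))) by lra.
  rewrite <- (Rmult_0_l (Series (fun k => 0))) , <- Series_scal_l.
  apply Series_le.
  - intros n; split; rewrite ?Rmult_0_l; auto with real.
  - apply (ex_series_incr_n x (S N)) in Hx. exact Hx.
Qed.

Lemma abs_bound_of_ex x :
  ex_series (fun k => Rabs (x k)) -> abs_bound x (Series (fun k => Rabs (x k))).
Proof.
  intros H N. apply sum_f_R0_le_Series; auto. intros; apply Rabs_pos.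
Qed.

Lemma abs_bound_le x y M :
  (forall k, Rabs (x k) <= Rabs (y k)) -> abs_bound y M -> abs_bound x M.
Proof.
  intros H Hy N. apply Rle_trans with (2 := Hy N).
  apply sum_Rle; auto.
Qed.

Lemma abs_bound_mono x M M' : M <= M' -> abs_bound x M -> abs_bound x M'.
Proof. intros H Hx N. apply Rle_trans with (1 := Hx N), H. Qed.

Lemma abs_bound_term x M k : abs_bound x M -> Rabs (x k) <= M.
Proof.
  intros H. apply Rle_trans with (2 := H k).
  destruct k; simpl; [lra|].
  pose proof (cond_pos_sum (fun k => Rabs (x k)) k (fun n => Rabs_pos _)). lra.
Qed.

Lemma Series_sum_f_R0 (y : nat -> nat -> R) N :
  (forall k, ex_series (fun n => y n k)) ->
  ex_series (fun n => sum_f_R0 (y n) N) /\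
  Series (fun n => sum_f_R0 (y n) N) = sum_f_R0 (fun k => Series (fun n => y n k)) N.
Proof.
  intros H. induction N as [|N [IH1 IH2]]; simpl; [split; auto|].
  split.
  - now apply (ex_series_plus (V := R_NormedModule)).
  - rewrite Series_plus by auto. now rewrite IH2.
Qed.

Section Swap.

Variables (x : nat -> nat -> R) (M : nat -> R).
Hypothesis Hx : forall n, abs_bound (x n) (M n).

Lemma column_abs_bound S k : abs_bound M S -> abs_bound (fun n => x n k) S.
Proof.
  intros HM. apply abs_bound_le with (2 := HM).
  intros n. apply Rle_trans with (2 := Rle_abs _). now apply abs_bound_term.
Qed.

(** A finite sum over columns commutes with the series over rows, and row [n] then contributes at
    most [M n]. *)
Lemma swap_abs_bound S :
  abs_bound M S -> abs_bound (fun k => Series (fun n => x n k)) S.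
Proof.
  intros HM N.
  assert (Hk : forall k, ex_series (fun n => Rabs (x n k))).
  { intros k. apply abs_bound_ex with (1 := column_abs_bound S k HM). }
  apply Rle_trans with (sum_f_R0 (fun k => Series (fun n => Rabs (x n k))) N).
  - apply sum_Rle. intros k _. now apply Series_Rabs.
  - destruct (Series_sum_f_R0 (fun n k => Rabs (x n k)) N Hk) as [E1 E2].
    rewrite <- E2. apply Rle_trans with (2 := abs_bound_Series_Rabs _ _ HM).
    apply Series_le; [|now apply abs_bound_ex with S].
    intros n; split.
    + apply cond_pos_sum. intros; apply Rabs_pos.
    + apply Rle_trans with (2 := Rle_abs _), Hx.
Qed.

End Swap.

(** Removing the rows up to [N] leaves a double sequence to which [swap_abs_bound] applies with the
    tail of the row bounds; this tail dominates the error of the [N]-th partial sum and tends to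
    0. *)
Lemma Series_swap (x : nat -> nat -> R) (M : nat -> R) (S : R) :
  (forall n, abs_bound (x n) (M n)) -> abs_bound M S ->
  Series (fun k => Series (fun n => x n k)) = Series (fun n => Series (x n)).
Proof.
  intros Hx HM.
  assert (HexM := abs_bound_ex _ _ HM).
  assert (Hs : ex_series (fun n => Series (x n))).
  { apply (ex_series_le (V := R_CompleteNormedModule)) with (2 := HexM).
    intros n. apply Rle_trans with (2 := Rle_abs _). now apply abs_bound_Series. }
  assert (Hcol : forall k, ex_series (fun n => x n k)).
  { intros k. apply ex_series_Rabs, (abs_bound_ex _ S). now apply column_abs_bound with M. }
  assert (Hc : ex_series (fun k => Series (fun n => x n k))).
  { apply ex_series_Rabs, (abs_bound_ex _ S). now apply swap_abs_bound with M. }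
  symmetry. apply is_series_unique.
  set (tail := fun N => Series (fun n => Rabs (M n)) - sum_f_R0 (fun n => Rabs (M n)) N).
  assert (Htail : is_lim_seq tail 0).
  { replace 0 with (Series (fun n => Rabs (M n)) - Series (fun n => Rabs (M n))) by ring.
    apply is_lim_seq_minus'; [apply is_lim_seq_const|].
    apply is_lim_seq_ext with (sum_n (fun n => Rabs (M n))).
    - intros n; apply sum_n_Reals.
    - exact (Series_correct _ HexM). }
  assert (Hbnd : forall N, Rabs (sum_f_R0 (fun n => Series (x n)) N
      - Series (fun k => Series (fun n => x n k))) <= tail N).
  { intros N.
    set (x' := fun n => x (Datatypes.S N + n)%nat).
    set (M' := fun n => M (Datatypes.S N + n)%nat).
    assert (HM' : abs_bound M' (tail N)).
    { unfold tail. rewrite (Series_incr_n _ (Datatypes.S N)) by (try lia; assumption).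
      simpl pred.
      apply abs_bound_mono with (Series (fun k => Rabs (M' k))).
      - unfold M'; simpl; lra.
      - apply abs_bound_of_ex. unfold M'.
        now apply (ex_series_incr_n (fun n => Rabs (M n)) (Datatypes.S N)). }
    assert (Hx' : forall n, abs_bound (x' n) (M' n)) by (intros; apply Hx).
    assert (Hsw := swap_abs_bound x' M' Hx' _ HM').
    destruct (Series_sum_f_R0 (fun k n => x n k) N) as [E1 E2].
    { intros n. apply ex_series_Rabs, (abs_bound_ex _ (M n)), Hx. }
    apply abs_bound_Series in Hsw.
    replace (Series (fun k => Series (fun n => x' n k))) with
      (Series (fun k => Series (fun n => x n k)) - sum_f_R0 (fun n => Series (x n)) N) in Hsw.
    { rewrite <- Rabs_Ropp. rewrite Ropp_minus_distr. exact Hsw. }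
    change (sum_f_R0 (fun n => Series (x n)) N)
      with (sum_f_R0 (fun n => Series (fun k => x n k)) N).
    rewrite <- E2, <- Series_minus by assumption.
    apply Series_ext. intros k.
    rewrite (Series_incr_n _ (Datatypes.S N)) by (try lia; apply Hcol).
    simpl pred. unfold x'. ring. }
  change (is_lim_seq (sum_n (fun n => Series (x n)))
    (Series (fun k => Series (fun n => x n k)))).
  apply is_lim_seq_ext with (sum_f_R0 (fun n => Series (x n))).
  { intros n; symmetry; apply sum_n_Reals. }
  apply is_lim_seq_spec. intros eps.
  apply is_lim_seq_spec in Htail. destruct (Htail eps) as [N0 HN0].
  exists N0. intros n Hn. apply Rle_lt_trans with (1 := Hbnd n).
  specialize (HN0 n Hn). rewrite Rminus_0_r in HN0.
  apply Rle_lt_trans with (1 := Rle_abs _) (2 := HN0).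
Qed.

(** * Weighted norms on power series *)

(** A weighted l1 norm: it is submultiplicative and dominates the values on [Rabs x <= r], so
    estimates can follow the shape of a formula. *)
Definition norm_le (r : R) (a : nat -> R) (M : R) : Prop :=
  abs_bound (fun k => a k * r ^ k) M.

Definition ps_add (a b : nat -> R) : nat -> R := fun k => a k + b k.
Definition ps_scal (c : R) (a : nat -> R) : nat -> R := fun k => c * a k.
Definition ps_const (c : R) : nat -> R := fun k => if Nat.eqb k 0 then c else 0.
Definition ps_var : nat -> R := fun k => if Nat.eqb k 1 then 1 else 0.
(** Substitution into the series [f]: with [X n] the powers of a series this is composition, with
    [X n] a part of [(c + s) ^ n] it is the corresponding part of [f (c + s)]. *)
Definition ps_comb (f : nat -> R) (X : nat -> nat -> R) : nat -> R :=
  fun k => Series (fun n => f n * X n k).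

Lemma norm_le_at r a M x :
  Rabs x <= r -> norm_le r a M -> abs_bound (fun k => a k * x ^ k) M.
Proof.
  intros Hx. apply abs_bound_le. intros k.
  rewrite !Rabs_mult, <- !RPow_abs.
  apply Rmult_le_compat_l; [apply Rabs_pos|].
  apply pow_incr; split; [apply Rabs_pos|].
  apply Rle_trans with (1 := Hx), Rle_abs.
Qed.

Lemma norm_le_shrink r r' a M : 0 <= r' <= r -> norm_le r a M -> norm_le r' a M.
Proof. intros H. apply norm_le_at. rewrite Rabs_pos_eq; lra. Qed.

Lemma norm_le_inside r a M x :
  Rabs x < r -> norm_le r a M -> Rbar_lt (Rabs x) (CV_radius a).
Proof.
  intros Hx Ha. apply Rbar_lt_le_trans with r; [exact Hx|].
  unfold CV_radius. destruct (Lub_Rbar_correct (CV_disk a)) as [H _].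
  apply H. apply (abs_bound_ex _ M Ha).
Qed.

Lemma inside_norm_le r a :
  0 <= r -> Rbar_lt r (CV_radius a) -> exists M, norm_le r a M.
Proof.
  intros Hr H. eexists. apply abs_bound_of_ex, CV_disk_inside.
  now rewrite Rabs_pos_eq.
Qed.

Lemma norm_le_is_pseries r a M x :
  Rabs x <= r -> norm_le r a M -> is_pseries a x (PSeries a x).
Proof.
  intros Hx Ha. apply PSeries_correct.
  apply ex_pseries_R, ex_series_Rabs, (abs_bound_ex _ M).
  now apply norm_le_at with r.
Qed.

Lemma norm_le_PSeries r a M x :
  Rabs x <= r -> norm_le r a M -> Rabs (PSeries a x) <= M.
Proof. intros Hx Ha. apply abs_bound_Series, (norm_le_at _ _ _ _ Hx Ha). Qed.

Lemma norm_le_mono r a M M' : M <= M' -> norm_le r a M -> norm_le r a M'.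
Proof. apply abs_bound_mono. Qed.

Lemma norm_le_pos r a M : norm_le r a M -> 0 <= M.
Proof. apply abs_bound_pos. Qed.

Lemma norm_le_add r a b M N :
  norm_le r a M -> norm_le r b N -> norm_le r (ps_add a b) (M + N).
Proof.
  intros Ha Hb n.
  apply Rle_trans with (2 := Rplus_le_compat _ _ _ _ (Ha n) (Hb n)).
  rewrite <- sum_plus. apply sum_Rle. intros k _. unfold ps_add.
  rewrite Rmult_plus_distr_r. apply Rabs_triang.
Qed.

Lemma norm_le_scal r c a M : norm_le r a M -> norm_le r (ps_scal c a) (Rabs c * M).
Proof.
  intros Ha n. unfold ps_scal.
  apply Rle_trans with (2 := Rmult_le_compat_l _ _ _ (Rabs_pos c) (Ha n)).
  rewrite scal_sum. apply sum_Rle. intros k _.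
  rewrite !Rabs_mult. lra.
Qed.

(** The coefficients of the Cauchy product are dominated by those of the product of the two series
    of absolute values, which has nonnegative terms. *)
Lemma norm_le_mult r a b M N :
  norm_le r a M -> norm_le r b N -> norm_le r (PS_mult a b) (M * N).
Proof.
  intros Ha Hb.
  pose (a' := fun k => Rabs (a k * r ^ k)). pose (b' := fun k => Rabs (b k * r ^ k)).
  assert (Ha' : ex_series a') by exact (abs_bound_ex _ _ Ha).
  assert (Hb' : ex_series b') by exact (abs_bound_ex _ _ Hb).
  assert (Hm := is_series_mult_pos a' b' _ _ (Series_correct _ Ha') (Series_correct _ Hb')
    (fun _ => Rabs_pos _) (fun _ => Rabs_pos _)).
  intros n.
  apply Rle_trans with
    (sum_f_R0 (fun n => sum_f_R0 (fun k => a' k * b' (n - k)%nat) n) n).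
  - apply sum_Rle. intros k _. unfold PS_mult.
    rewrite Rmult_comm, scal_sum.
    apply Rle_trans with (1 := Rsum_abs _ _). apply sum_Rle. intros i Hi.
    unfold a', b'. rewrite <- Rabs_mult. apply Req_le. f_equal.
    replace k with (i + (k - i))%nat at 2 by lia. rewrite pow_add. ring.
  - apply Rle_trans with (Series a' * Series b').
    + rewrite <- (is_series_unique _ _ Hm). apply sum_f_R0_le_Series.
      * intros k. apply cond_pos_sum. intros i. apply Rmult_le_pos; apply Rabs_pos.
      * eexists; exact Hm.
    + apply Rmult_le_compat.
      * apply Rle_trans with (2 := sum_f_R0_le_Series a' 0%nat (fun _ => Rabs_pos _) Ha').
        apply Rabs_pos.
      * apply Rle_trans with (2 := sum_f_R0_le_Series b' 0%nat (fun _ => Rabs_pos _) Hb').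
        apply Rabs_pos.
      * now apply abs_bound_Series_Rabs.
      * now apply abs_bound_Series_Rabs.
Qed.

Lemma norm_le_const r c : norm_le r (ps_const c) (Rabs c).
Proof.
  intros n. apply Req_le. induction n as [|n IH]; simpl sum_f_R0.
  - unfold ps_const; simpl. now rewrite Rmult_1_r.
  - rewrite IH. unfold ps_const; simpl. rewrite Rmult_0_l, Rabs_R0. ring.
Qed.

Lemma norm_le_var r : 0 <= r -> norm_le r ps_var r.
Proof.
  intros Hr n.
  enough (sum_f_R0 (fun k => Rabs (ps_var k * r ^ k)) n =
    match n with O => 0 | _ => r end) as -> by (destruct n; lra).
  induction n as [|n IH]; simpl sum_f_R0.
  - unfold ps_var; simpl. now rewrite Rmult_0_l, Rabs_R0.
  - rewrite IH. destruct n; unfold ps_var; simpl.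
    + rewrite Rabs_pos_eq; lra.
    + rewrite Rmult_0_l, Rabs_R0. ring.
Qed.

Lemma PSeries_ps_const c x : PSeries (ps_const c) x = c.
Proof.
  rewrite PSeries_decr_1.
  - rewrite (PSeries_ext (PS_decr_1 (ps_const c)) (fun _ => 0)) by reflexivity.
    rewrite PSeries_const_0. unfold ps_const; simpl. ring.
  - eexists. apply (norm_le_is_pseries (Rabs x) _ _ _ (Rle_refl _) (norm_le_const _ c)).
Qed.

Lemma PSeries_ps_var x : PSeries ps_var x = x.
Proof.
  rewrite PSeries_decr_1_aux by reflexivity.
  rewrite (PSeries_ext _ (ps_const 1)) by (intros [|]; reflexivity).
  rewrite PSeries_ps_const; ring.
Qed.

Lemma PSeries_ps_scal c a x : PSeries (ps_scal c a) x = c * PSeries a x.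
Proof. apply PSeries_scal. Qed.

Lemma PSeries_ps_add r a b M N x :
  norm_le r a M -> norm_le r b N -> Rabs x <= r ->
  PSeries (ps_add a b) x = PSeries a x + PSeries b x.
Proof.
  intros Ha Hb Hx. apply PSeries_plus.
  - eexists. apply (norm_le_is_pseries _ _ _ _ Hx Ha).
  - eexists. apply (norm_le_is_pseries _ _ _ _ Hx Hb).
Qed.

Lemma PSeries_ps_mult r a b M N x :
  norm_le r a M -> norm_le r b N -> Rabs x < r ->
  PSeries (PS_mult a b) x = PSeries a x * PSeries b x.
Proof.
  intros Ha Hb Hx. apply PSeries_mult.
  - apply (norm_le_inside _ _ _ _ Hx Ha).
  - apply (norm_le_inside _ _ _ _ Hx Hb).
Qed.

Section Comb.

Variables (r : R) (f : nat -> R) (X : nat -> nat -> R) (B : nat -> R) (M : R).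
Hypothesis HX : forall n, norm_le r (X n) (B n).
Hypothesis Hf : abs_bound (fun n => f n * B n) M.

Let term x n := abs_bound (fun k => f n * X n k * x ^ k) (Rabs (f n) * B n).

Lemma ps_comb_term x n : Rabs x <= r -> term x n.
Proof.
  intros Hx N.
  assert (H := norm_le_at _ _ _ _ Hx (norm_le_scal _ (f n) _ _ (HX n))).
  exact (H N).
Qed.

Lemma ps_comb_weights : abs_bound (fun n => Rabs (f n) * B n) M.
Proof.
  apply abs_bound_le with (2 := Hf). intros n. rewrite !Rabs_mult, Rabs_Rabsolu. lra.
Qed.

Lemma norm_le_comb : 0 <= r -> norm_le r (ps_comb f X) M.
Proof.
  intros Hr.
  assert (Hrr : Rabs r <= r) by (rewrite Rabs_pos_eq; lra).
  apply abs_bound_le with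
    (2 := swap_abs_bound _ _ (fun n => ps_comb_term r n Hrr) M ps_comb_weights).
  intros k. unfold ps_comb. rewrite (Rmult_comm _ (r ^ k)), <- Series_scal_l.
  right. f_equal. apply Series_ext. intros n; ring.
Qed.

Lemma PSeries_comb x :
  Rabs x <= r -> PSeries (ps_comb f X) x = Series (fun n => f n * PSeries (X n) x).
Proof.
  intros Hx. unfold PSeries at 1, ps_comb.
  rewrite (Series_ext _ (fun k => Series (fun n => f n * X n k * x ^ k))).
  2:{ intros k. rewrite (Rmult_comm _ (x ^ k)), <- Series_scal_l.
      apply Series_ext; intros n; ring. }
  rewrite (Series_swap _ _ M (fun n => ps_comb_term x n Hx) ps_comb_weights).
  apply Series_ext. intros n. unfold PSeries. rewrite <- Series_scal_l.
  apply Series_ext; intros k; ring.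
Qed.

End Comb.

(** * Agreement of power series up to a given order *)

Definition ps_agree (k : nat) (a b : nat -> R) : Prop :=
  forall j, (j < k)%nat -> a j = b j.

Lemma ps_agree_refl k a : ps_agree k a a.
Proof. now intros j _. Qed.

Lemma ps_agree_trans k a b c : ps_agree k a b -> ps_agree k b c -> ps_agree k a c.
Proof. intros H1 H2 j Hj. now rewrite H1, H2. Qed.

Lemma ps_agree_weaken k k' a b : (k' <= k)%nat -> ps_agree k a b -> ps_agree k' a b.
Proof. intros H1 H2 j Hj. apply H2; lia. Qed.

Lemma ps_agree_add k a a' b b' :
  ps_agree k a a' -> ps_agree k b b' -> ps_agree k (ps_add a b) (ps_add a' b').
Proof. intros H1 H2 j Hj. unfold ps_add. now rewrite H1, H2. Qed.

Lemma ps_agree_scal k c a a' :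
  ps_agree k a a' -> ps_agree k (ps_scal c a) (ps_scal c a').
Proof. intros H1 j Hj. unfold ps_scal. now rewrite H1. Qed.

Lemma ps_agree_mult k a a' b b' :
  ps_agree k a a' -> ps_agree k b b' -> ps_agree k (PS_mult a b) (PS_mult a' b').
Proof.
  intros H1 H2 j Hj. unfold PS_mult. apply sum_eq. intros i Hi.
  rewrite H1, H2; auto; lia.
Qed.

(** With both constant terms zero, coefficient [k] of the product involves only coefficients of
    index 1 to [k - 1]. This is where the iteration gains an order. *)
Lemma ps_agree_mult_S k a a' b b' :
  a 0%nat = 0 -> a' 0%nat = 0 -> b 0%nat = 0 -> b' 0%nat = 0 ->
  ps_agree k a a' -> ps_agree k b b' -> ps_agree (S k) (PS_mult a b) (PS_mult a' b').
Proof.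
  intros Ha Ha' Hb Hb' H1 H2 j Hj. unfold PS_mult. apply sum_eq. intros i Hi.
  destruct (Nat.eq_dec i 0) as [->|Hi0]; [rewrite Ha, Ha'; ring|].
  destruct (Nat.eq_dec i j) as [->|Hij].
  { rewrite Nat.sub_diag, Hb, Hb'; ring. }
  rewrite H1, H2; auto; lia.
Qed.

Lemma ps_agree_comb k f X X' :
  (forall n, f n = 0 \/ ps_agree k (X n) (X' n)) ->
  ps_agree k (ps_comb f X) (ps_comb f X').
Proof.
  intros H j Hj. unfold ps_comb. apply Series_ext. intros n.
  destruct (H n) as [->|E]; [ring|]. now rewrite E.
Qed.

Lemma ps_add_at a b k : ps_add a b k = a k + b k.
Proof. reflexivity. Qed.

Lemma PS_mult_0 a b : PS_mult a b 0%nat = a 0%nat * b 0%nat.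
Proof. reflexivity. Qed.

Lemma ps_comb_0 f X :
  (forall n, f n = 0 \/ X n 0%nat = 0) -> ps_comb f X 0%nat = 0.
Proof.
  intros H. unfold ps_comb. rewrite (Series_ext _ (fun n => 0 * 0)).
  - rewrite Series_scal_l. ring.
  - intros n. destruct (H n) as [->| ->]; ring.
Qed.

(** The source of all smallness: a zero of order [m] turns a smaller radius into a factor
    [(r / rho) ^ m]. *)
Lemma norm_le_vanish m r rho f K :
  (forall k, (k < m)%nat -> f k = 0) -> 0 <= r <= rho -> 0 < rho ->
  norm_le rho f K -> norm_le r f (K * (r / rho) ^ m).
Proof.
  intros Hf Hr Hrho HK.
  assert (Hq : 0 <= r / rho <= 1).
  { split; [apply Rdiv_le_0_compat; lra|]. apply Rle_div_l; lra. }
  intros N. apply Rle_trans with (sum_f_R0 (fun k => Rabs (f k * rho ^ k)) N * (r / rho) ^ m).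
  2:{ apply Rmult_le_compat_r; [apply pow_le; lra|apply HK]. }
  rewrite Rmult_comm, scal_sum. apply sum_Rle. intros k _.
  destruct (Compare_dec.lt_dec k m) as [Hk|Hk].
  { rewrite Hf by assumption. rewrite !Rmult_0_l, Rabs_R0. lra. }
  replace (r ^ k) with (rho ^ k * ((r / rho) ^ m * (r / rho) ^ (k - m))).
  2:{ rewrite <- pow_add. replace (m + (k - m))%nat with k by lia.
      rewrite <- Rpow_mult_distr.
      f_equal; field; lra. }
  rewrite <- !Rmult_assoc, Rabs_mult, (Rabs_mult (f k * _)).
  rewrite (Rabs_pos_eq ((r / rho) ^ m)) by (apply pow_le; lra).
  rewrite (Rabs_pos_eq ((r / rho) ^ _)) by (apply pow_le; lra).
  rewrite <- (Rmult_1_r (Rabs _ * _)) at 2.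
  apply Rmult_le_compat_l.
  - apply Rmult_le_pos; [apply Rabs_pos|apply pow_le; lra].
  - rewrite <- (pow1 (k - m)). now apply pow_incr.
Qed.

(** * Recentering *)

Fixpoint ps_pow (g : nat -> R) (n : nat) : nat -> R :=
  match n with
  | O => ps_const 1
  | S n => PS_mult g (ps_pow g n)
  end.

Lemma norm_le_pow r g M n : norm_le r g M -> norm_le r (ps_pow g n) (M ^ n).
Proof.
  intros Hg. induction n as [|n IH]; simpl.
  - apply norm_le_mono with (Rabs 1); [rewrite Rabs_R1; lra|apply norm_le_const].
  - now apply norm_le_mult.
Qed.

Lemma PSeries_ps_pow r g M n x :
  norm_le r g M -> Rabs x < r -> PSeries (ps_pow g n) x = PSeries g x ^ n.
Proof.
  intros Hg Hx. induction n as [|n IH]; simpl.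
  - apply PSeries_ps_const.
  - rewrite (PSeries_ps_mult r _ _ M (M ^ n)); auto.
    + now rewrite IH.
    + now apply norm_le_pow.
Qed.

(** The recentered series is [a] composed with [x0 + X]. On radius [r - Rabs x0] the inner series
    has norm at most [r], exactly what [a] tolerates. *)
Lemma PSeries_analytic r a M t0 t1 :
  norm_le r a M -> Rabs (t1 - t0) < r ->
  analytic_at (fun t => PSeries a (t - t0)) t1.
Proof.
  intros Ha Ht. set (x0 := t1 - t0) in *.
  pose (g := ps_add (ps_const x0) ps_var).
  exists (ps_comb a (ps_pow g)).
  set (r' := r - Rabs x0). assert (Hr' : 0 < r') by (unfold r'; lra).
  assert (Hg : norm_le r' g r).
  { replace r with (Rabs x0 + r') at 1 by (unfold r'; ring).
    apply norm_le_add; [apply norm_le_const|apply norm_le_var; lra]. }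
  exists (mkposreal r' Hr'). intros t Hball.
  assert (Hh : Rabs (t - t1) < r') by exact Hball.
  assert (Hpow := fun n => norm_le_pow r' g r n Hg).
  assert (Hc := norm_le_comb r' a (ps_pow g) (fun n => r ^ n) M Hpow Ha (Rlt_le _ _ Hr')).
  replace (PSeries a (t - t0)) with (PSeries (ps_comb a (ps_pow g)) (t - t1)).
  { apply (norm_le_is_pseries r' _ M); [lra|exact Hc]. }
  rewrite (PSeries_comb r' a (ps_pow g) (fun n => r ^ n) M Hpow Ha) by lra.
  unfold PSeries at 2. apply Series_ext. intros n.
  rewrite (PSeries_ps_pow r' g r n _ Hg Hh). f_equal. f_equal.
  unfold g. rewrite (PSeries_ps_add r' _ _ (Rabs x0) r').
  - rewrite PSeries_ps_const, PSeries_ps_var. unfold x0; ring.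
  - apply norm_le_const.
  - apply norm_le_var; lra.
  - lra.
Qed.

(** * Fixed points and square roots *)

(** Convergence of the iteration is formal: each step gains one correct coefficient,
    so no contraction estimate is needed, only an invariant ball. *)
Section FixedPoint.

Variables (Phi Psi : (nat -> R) -> (nat -> R) -> nat -> R) (r Ma Mb : R).

Definition in_ball (a b : nat -> R) : Prop :=
  (a 0%nat = 0 /\ norm_le r a Ma) /\ (b 0%nat = 0 /\ norm_le r b Mb).

Hypothesis Ma_pos : 0 <= Ma.
Hypothesis Mb_pos : 0 <= Mb.
Hypothesis Phi_ball : forall a b, in_ball a b -> Phi a b 0%nat = 0 /\ norm_le r (Phi a b) Ma.
Hypothesis Psi_ball : forall a b, in_ball a b -> Psi a b 0%nat = 0 /\ norm_le r (Psi a b) Mb.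
Hypothesis Phi_agree : forall k a b a' b', in_ball a b -> in_ball a' b' ->
  ps_agree k a a' -> ps_agree (S k) b b' -> ps_agree (S k) (Phi a b) (Phi a' b').
Hypothesis Psi_agree : forall k a b a' b', in_ball a b -> in_ball a' b' ->
  ps_agree k a a' -> ps_agree k b b' -> ps_agree (S k) (Psi a b) (Psi a' b').

(** The second component already uses the new first one. If [a] is known below index [k] and [b]
    below [S k], then [Phi] yields [a] below [S k], and only then does [Psi] yield [b] below
    [S (S k)]; [Phi] may thus depend on [b] without a gain in order. *)
Let step (u : (nat -> R) * (nat -> R)) :=
  let a := Phi (fst u) (snd u) in (a, Psi a (snd u)).
Let it n := Nat.iter n step (ps_const 0, ps_const 0).
Let a_ n := fst (it n).
Let b_ n := snd (it n).

Lemma iterate_in_ball n : in_ball (a_ n) (b_ n).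
Proof.
  induction n as [|n IH].
  - assert (H0 : forall M, 0 <= M -> norm_le r (ps_const 0) M).
    { intros M HM.
      apply norm_le_mono with (Rabs 0); [rewrite Rabs_R0; lra|apply norm_le_const]. }
    repeat split; auto.
  - assert (Ha := Phi_ball _ _ IH). split; [exact Ha|].
    apply (Psi_ball (Phi (a_ n) (b_ n)) (b_ n)). split; [exact Ha|apply IH].
Qed.

Lemma iterate_step n :
  a_ (S n) = Phi (a_ n) (b_ n) /\ b_ (S n) = Psi (a_ (S n)) (b_ n).
Proof. split; reflexivity. Qed.

Lemma iterate_mixed_ball n : in_ball (a_ (S n)) (b_ n).
Proof. split; [apply (iterate_in_ball (S n))|apply (iterate_in_ball n)]. Qed.

Lemma iterate_agree_S n :
  ps_agree n (a_ n) (a_ (S n)) /\ ps_agree (S n) (b_ n) (b_ (S n)).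
Proof.
  induction n as [|n [IHa IHb]].
  - split; intros j Hj; [lia|]. replace j with 0%nat by lia.
    now rewrite (proj1 (proj2 (iterate_in_ball 1))).
  - assert (Ha : ps_agree (S n) (a_ (S n)) (a_ (S (S n)))).
    { rewrite (proj1 (iterate_step (S n))).
      rewrite (proj1 (iterate_step n)) at 1.
      apply Phi_agree; auto using iterate_in_ball. }
    split; [exact Ha|].
    rewrite (proj2 (iterate_step (S n))).
    rewrite (proj2 (iterate_step n)) at 1.
    apply Psi_agree; auto using iterate_mixed_ball.
Qed.

Lemma iterate_agree n m : (n <= m)%nat ->
  ps_agree n (a_ n) (a_ m) /\ ps_agree (S n) (b_ n) (b_ m).
Proof.
  intros Hnm. induction Hnm as [|m Hm [IHa IHb]].
  - split; apply ps_agree_refl.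
  - destruct (iterate_agree_S m) as [Ha Hb]. split.
    + apply ps_agree_trans with (1 := IHa), ps_agree_weaken with (2 := Ha); lia.
    + apply ps_agree_trans with (1 := IHb), ps_agree_weaken with (2 := Hb); lia.
Qed.

(** The indices differ because [a_ n] is final below [n] but [b_ n] already below [S n]. *)
Let a_lim k := a_ (S k) k.
Let b_lim k := b_ k k.

Lemma limit_agree n : ps_agree n a_lim (a_ n) /\ ps_agree (S n) b_lim (b_ n).
Proof.
  split; intros j Hj.
  - apply (iterate_agree (S j) n); lia.
  - apply (iterate_agree j n); lia.
Qed.

(** A norm bound is a bound on every partial sum, and a partial sum of the limit is a partial sum of
    some iterate. *)
Lemma limit_in_ball : in_ball a_lim b_lim.
Proof.
  split; split.
  - apply (iterate_in_ball 1).
  - intros N. apply Rle_trans with (2 := proj2 (proj1 (iterate_in_ball (S N))) N).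
    apply Req_le, sum_eq. intros i Hi. now rewrite (proj1 (limit_agree (S N)) i) by lia.
  - apply (iterate_in_ball 0).
  - intros N. apply Rle_trans with (2 := proj2 (proj2 (iterate_in_ball N)) N).
    apply Req_le, sum_eq. intros i Hi. now rewrite (proj2 (limit_agree N) i) by lia.
Qed.

Lemma ps_fixed_point :
  exists a b, in_ball a b /\ forall k, a k = Phi a b k /\ b k = Psi a b k.
Proof.
  exists a_lim, b_lim. split; [apply limit_in_ball|]. intros k.
  destruct (limit_agree k) as [Hak Hbk]. destruct (limit_agree (S k)) as [HaS HbS].
  split.
  - rewrite (HaS k) by lia. symmetry. rewrite (proj1 (iterate_step k)).
    apply (Phi_agree k); auto using limit_in_ball, iterate_in_ball.
  - rewrite (HbS k) by lia. symmetry. rewrite (proj2 (iterate_step k)).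
    apply (Psi_agree (S k)); auto using limit_in_ball, iterate_mixed_ball.
Qed.

End FixedPoint.

(** The equation reads [p = (g - p ^ 2) / 2], and the ball of radius 1/2 is invariant because
    [(1 / 2 + 1 / 4) / 2 <= 1 / 2]. *)
Lemma ps_sqrt_1 r g :
  g 0%nat = 0 -> norm_le r g (1 / 2) ->
  exists p, norm_le r p (1 / 2) /\
    forall x, Rabs x < r -> (1 + PSeries p x) ^ 2 = 1 + PSeries g x.
Proof.
  intros Hg0 Hg.
  pose (Psi := fun a p : nat -> R => ps_scal (1 / 2) (ps_add g (ps_scal (-1) (PS_mult p p)))).
  (* There is one unknown only; the first component is kept at 0. *)
  destruct (ps_fixed_point (fun _ _ => ps_const 0) Psi r 0 (1 / 2)) as (a & p & Hp & E).
  - lra.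
  - lra.
  - intros a p _. split; [reflexivity|].
    apply norm_le_mono with (Rabs 0); [rewrite Rabs_R0; lra|apply norm_le_const].
  - intros a p [_ [Hp0 Hp]]. split.
    + unfold Psi, ps_scal, ps_add. rewrite PS_mult_0, Hg0, Hp0. ring.
    + eapply norm_le_mono.
      2:{ apply norm_le_scal, norm_le_add; [exact Hg|].
          apply norm_le_scal, norm_le_mult; exact Hp. }
      rewrite (Rabs_pos_eq (1 / 2)), Rabs_left; lra.
  - intros; apply ps_agree_refl.
  - intros k a p a' p' [_ [Hp0 _]] [_ [Hp0' _]] _ Hpp.
    apply ps_agree_scal, ps_agree_add; [apply ps_agree_refl|].
    now apply ps_agree_scal, ps_agree_mult_S.
  - exists p. destruct Hp as [_ [Hp0 Hp]]. split; [exact Hp|]. intros x Hx.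
    assert (Hx' : PSeries p x = PSeries (Psi a p) x) by (apply PSeries_ext; apply E).
    assert (Hpp := norm_le_mult _ _ _ _ _ Hp Hp).
    unfold Psi in Hx'. rewrite PSeries_ps_scal in Hx'.
    rewrite (PSeries_ps_add _ _ _ _ _ _ Hg (norm_le_scal _ (-1) _ _ Hpp) (Rlt_le _ _ Hx)) in Hx'.
    rewrite PSeries_ps_scal, (PSeries_ps_mult _ _ _ _ _ _ Hp Hp Hx) in Hx'.
    lra.
Qed.

Lemma ps_sqrt rho a M :
  0 < rho -> norm_le rho a M -> 0 < a 0%nat ->
  exists r b N, 0 < r <= rho /\ norm_le r b N /\
    forall x, Rabs x < r -> 0 < PSeries b x /\ PSeries b x ^ 2 = PSeries a x.
Proof.
  intros Hrho Ha Ha0.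
  pose (g := ps_add (ps_scal (/ a 0%nat) a) (ps_const (-1))).
  assert (Hg0 : g 0%nat = 0).
  { unfold g, ps_add, ps_scal, ps_const; simpl; field; lra. }
  assert (Hg := norm_le_add _ _ _ _ _ (norm_le_scal _ (/ a 0%nat) _ _ Ha)
    (norm_le_const rho (-1))). fold g in Hg.
  set (K := Rabs (/ a 0%nat) * M + Rabs (-1)) in *.
  assert (HK := norm_le_pos _ _ _ Hg).
  (* As [g] has no constant term, its norm on this radius is at most [K / (2 * K + 1) <= 1 / 2]. *)
  pose (r := rho / (2 * K + 1)).
  assert (Hr : 0 < r <= rho).
  { unfold r; split; [apply Rdiv_lt_0_compat; lra|]. apply Rle_div_l; nra. }
  assert (Hg' : norm_le r g (1 / 2)).
  { apply norm_le_mono with (K * (r / rho) ^ 1).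
    - unfold r. replace (rho / (2 * K + 1) / rho) with (/ (2 * K + 1)) by (field; lra).
      rewrite pow_1. apply Rle_div_l; lra.
    - apply norm_le_vanish; auto; try lra. intros k Hk. now replace k with 0%nat by lia. }
  destruct (ps_sqrt_1 r g Hg0 Hg') as (p & Hp & E).
  exists r, (ps_scal (sqrt (a 0%nat)) (ps_add (ps_const 1) p)). eexists.
  split; [exact Hr|]. split.
  { apply norm_le_scal, norm_le_add; [apply norm_le_const|exact Hp]. }
  intros x Hx. rewrite PSeries_ps_scal.
  rewrite (PSeries_ps_add _ _ _ _ _ _ (norm_le_const r 1) Hp (Rlt_le _ _ Hx)).
  rewrite PSeries_ps_const. specialize (E x Hx).
  assert (Hpx := norm_le_PSeries _ _ _ _ (Rlt_le _ _ Hx) Hp). apply Rabs_le_between in Hpx.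
  split.
  - apply Rmult_lt_0_compat; [now apply sqrt_lt_R0|lra].
  - rewrite Rpow_mult_distr, pow2_sqrt, E by lra. unfold g.
    rewrite (PSeries_ps_add rho _ _ _ _ _ (norm_le_scal _ (/ a 0%nat) _ _ Ha)
      (norm_le_const rho (-1))) by lra.
    rewrite PSeries_ps_scal, PSeries_ps_const. field; lra.
Qed.

(** * Evaluation at [c + s] and [c - s] *)

Record parts (T : Type) : Type := Parts { ev : T; od : T; ev2 : T; od2 : T }.
Arguments Parts {T}.
Arguments ev {T}.
Arguments od {T}.
Arguments ev2 {T}.
Arguments od2 {T}.

(** With [q = s * s]: [(c + s) ^ n = ev + s * od], and
    [ev = c ^ n + q * ev2], [od = n * c ^ (n - 1) + q * od2]. *)
Fixpoint power_parts {T : Type} (add mul : T -> T -> T) (zero one c q : T) (n : nat)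
    : parts T :=
  match n with
  | O => Parts one zero zero zero
  | S n =>
      let p := power_parts add mul zero one c q n in
      Parts (add (mul c (ev p)) (mul q (od p)))
            (add (ev p) (mul c (od p)))
            (add (mul c (ev2 p)) (od p))
            (add (ev2 p) (mul c (od2 p)))
  end.

Notation ps_parts := (power_parts ps_add PS_mult (ps_const 0) (ps_const 1)).
Notation r_parts := (power_parts Rplus Rmult 0 1).

(** With [c] and [s] of size [eta], [(c + s) ^ n] has size [(2 * eta) ^ n], and each division by [s]
    costs a factor [1 / eta]: none for [ev], one for [od], two for [ev2], three for [od2]. The
    recursion reproduces these bounds exactly. *)
Lemma norm_le_parts r c q eta n :
  0 < eta -> norm_le r c eta -> norm_le r q (eta ^ 2) ->
  norm_le r (ev (ps_parts c q n)) ((2 * eta) ^ n) /\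
  norm_le r (od (ps_parts c q n)) ((2 * eta) ^ n / eta) /\
  norm_le r (ev2 (ps_parts c q n)) ((2 * eta) ^ n / eta ^ 2) /\
  norm_le r (od2 (ps_parts c q n)) ((2 * eta) ^ n / eta ^ 3).
Proof.
  intros HR Hc Hq.
  assert (Hi : 0 <= / eta) by (left; now apply Rinv_0_lt_compat).
  induction n as [|n (H1 & H2 & H3 & H4)]; simpl power_parts; cbn [ev od ev2 od2].
  - assert (H0 : forall M, 0 <= M -> norm_le r (ps_const 0) M).
    { intros M HM. apply norm_le_mono with (Rabs 0); [rewrite Rabs_R0; lra|].
      apply norm_le_const. }
    split; [|repeat split; apply H0].
    + apply norm_le_mono with (Rabs 1); [rewrite Rabs_R1; simpl; lra|apply norm_le_const].
    + apply Rmult_le_pos; simpl; lra.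
    + left; apply Rdiv_lt_0_compat; [simpl; lra|now apply pow_lt].
    + left; apply Rdiv_lt_0_compat; [simpl; lra|now apply pow_lt].
  - repeat split.
    + replace ((2 * eta) ^ S n) with (eta * (2 * eta) ^ n + eta ^ 2 * ((2 * eta) ^ n / eta))
        by (simpl; field; lra).
      apply norm_le_add; now apply norm_le_mult.
    + replace ((2 * eta) ^ S n / eta) with ((2 * eta) ^ n + eta * ((2 * eta) ^ n / eta))
        by (simpl; field; lra).
      apply norm_le_add; [assumption|now apply norm_le_mult].
    + replace ((2 * eta) ^ S n / eta ^ 2)
        with (eta * ((2 * eta) ^ n / eta ^ 2) + (2 * eta) ^ n / eta)
        by (simpl; field; lra).
      apply norm_le_add; [now apply norm_le_mult|assumption].
    + replace ((2 * eta) ^ S n / eta ^ 3)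
        with ((2 * eta) ^ n / eta ^ 2 + eta * ((2 * eta) ^ n / eta ^ 3)) by (simpl; field; lra).
      apply norm_le_add; [assumption|now apply norm_le_mult].
Qed.

Lemma PSeries_parts r c q eta n x :
  0 < eta -> norm_le r c eta -> norm_le r q (eta ^ 2) -> Rabs x < r ->
  PSeries (ev (ps_parts c q n)) x = ev (r_parts (PSeries c x) (PSeries q x) n) /\
  PSeries (od (ps_parts c q n)) x = od (r_parts (PSeries c x) (PSeries q x) n) /\
  PSeries (ev2 (ps_parts c q n)) x = ev2 (r_parts (PSeries c x) (PSeries q x) n) /\
  PSeries (od2 (ps_parts c q n)) x = od2 (r_parts (PSeries c x) (PSeries q x) n).
Proof.
  intros HR Hc Hq Hx. assert (Hx' := Rlt_le _ _ Hx).
  induction n as [|n (E1 & E2 & E3 & E4)]; simpl power_parts; cbn [ev od ev2 od2].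
  - repeat split; apply PSeries_ps_const.
  - destruct (norm_le_parts r c q eta n HR Hc Hq) as (H1 & H2 & H3 & H4).
    repeat split; erewrite PSeries_ps_add;
      try (apply norm_le_mult; eassumption); try eassumption;
      repeat (erewrite (PSeries_ps_mult r _ _ _ _ x) by eassumption);
      now rewrite ?E1, ?E2, ?E3, ?E4.
Qed.

(** * Truncation, vanishing orders and agreement of the parts *)

Definition ps_trunc (m : nat) (f : nat -> R) : nat -> R :=
  fun n => if Nat.ltb n m then 0 else f n.

Lemma ps_trunc_lt m f n : (n < m)%nat -> ps_trunc m f n = 0.
Proof. intros H. unfold ps_trunc. now rewrite (proj2 (Nat.ltb_lt _ _) H). Qed.

Lemma ps_trunc_ge m f n : (m <= n)%nat -> ps_trunc m f n = f n.
Proof. intros H. unfold ps_trunc. now rewrite (proj2 (Nat.ltb_ge _ _) H). Qed.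

Lemma norm_le_trunc r m f M : norm_le r f M -> norm_le r (ps_trunc m f) M.
Proof.
  apply abs_bound_le. intros k. unfold ps_trunc. destruct (Nat.ltb k m); [|lra].
  rewrite Rmult_0_l, Rabs_R0. apply Rabs_pos.
Qed.

(** Giving [c] weight 1 and [q] weight 2, the four parts are homogeneous of weights [n], [n - 1],
    [n - 2], [n - 3]; positive weight forces a zero constant term. *)
Lemma parts_const_0 c q n :
  c 0%nat = 0 -> q 0%nat = 0 ->
  ((1 <= n)%nat -> ev (ps_parts c q n) 0%nat = 0) /\
  ((2 <= n)%nat -> od (ps_parts c q n) 0%nat = 0) /\
  ((3 <= n)%nat -> ev2 (ps_parts c q n) 0%nat = 0) /\
  ((4 <= n)%nat -> od2 (ps_parts c q n) 0%nat = 0).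
Proof.
  intros Hc Hq.
  induction n as [|n (H1 & H2 & H3 & H4)]; [repeat split; lia|].
  simpl power_parts; cbn [ev od ev2 od2]; rewrite ?ps_add_at, !PS_mult_0, Hc, ?Hq.
  repeat split; intros Hn.
  - ring.
  - rewrite H1 by lia; ring.
  - rewrite H2 by lia; ring.
  - rewrite H3 by lia; ring.
Qed.

(** The coefficient of [b] that is not known to agree is met only by [a 0 = 0]. *)
Lemma ps_agree_mult_l k a a' b b' :
  a 0%nat = 0 -> a' 0%nat = 0 ->
  ps_agree (S k) a a' -> ps_agree k b b' -> ps_agree (S k) (PS_mult a b) (PS_mult a' b').
Proof.
  intros Ha Ha' H1 H2 j Hj. unfold PS_mult. apply sum_eq. intros i Hi.
  destruct (Nat.eq_dec i 0) as [->|Hi0]; [rewrite Ha, Ha'; ring|].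
  rewrite H1, H2; auto; lia.
Qed.

Section PartsAgree.

Variables (c q c' q' : nat -> R) (k : nat).
Hypothesis Hc : c 0%nat = 0.
Hypothesis Hq : q 0%nat = 0.
Hypothesis Hc' : c' 0%nat = 0.
Hypothesis Hq' : q' 0%nat = 0.
Hypothesis Ac : ps_agree k c c'.

Lemma parts_agree n :
  ps_agree k q q' ->
  ps_agree k (ev (ps_parts c q n)) (ev (ps_parts c' q' n)) /\
  ps_agree k (od (ps_parts c q n)) (od (ps_parts c' q' n)) /\
  ps_agree k (ev2 (ps_parts c q n)) (ev2 (ps_parts c' q' n)) /\
  ps_agree k (od2 (ps_parts c q n)) (od2 (ps_parts c' q' n)).
Proof.
  intros Aq.
  induction n as [|n (H1 & H2 & H3 & H4)]; [repeat split; apply ps_agree_refl|].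
  simpl power_parts; cbn [ev od ev2 od2].
  repeat split; auto using ps_agree_add, ps_agree_mult.
Qed.

(** In weight at least 3 every monomial in [c] and [q] has two factors, each with zero constant
    term, so an order is gained in both variables. Weight 2 would allow a bare [q]. *)
Lemma parts_agree_S_same n :
  ps_agree k q q' ->
  ((3 <= n)%nat -> ps_agree (S k) (ev (ps_parts c q n)) (ev (ps_parts c' q' n))) /\
  ((4 <= n)%nat -> ps_agree (S k) (od (ps_parts c q n)) (od (ps_parts c' q' n))).
Proof.
  intros Aq. induction n as [|n (H1 & H2)]; [split; lia|].
  destruct (parts_agree n Aq) as (A1 & A2 & _).
  destruct (parts_const_0 c q n Hc Hq) as (Z1 & Z2 & _).
  destruct (parts_const_0 c' q' n Hc' Hq') as (Z1' & Z2' & _).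
  simpl power_parts; cbn [ev od].
  split; intros Hn; apply ps_agree_add.
  - apply ps_agree_mult_S; auto; [apply Z1|apply Z1']; lia.
  - apply ps_agree_mult_S; auto; [apply Z2|apply Z2']; lia.
  - apply H1; lia.
  - apply ps_agree_mult_S; auto; [apply Z2|apply Z2']; lia.
Qed.

(** In weight at least 2 a bare [c] is excluded but a bare [q] is not; hence [q] must agree to one
    order more than [c]. The thresholds on [n] are those at which the four weights reach 2. *)
Lemma parts_agree_S n :
  ps_agree (S k) q q' ->
  ((2 <= n)%nat -> ps_agree (S k) (ev (ps_parts c q n)) (ev (ps_parts c' q' n))) /\
  ((3 <= n)%nat -> ps_agree (S k) (od (ps_parts c q n)) (od (ps_parts c' q' n))) /\
  ((4 <= n)%nat -> ps_agree (S k) (ev2 (ps_parts c q n)) (ev2 (ps_parts c' q' n))) /\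
  ((5 <= n)%nat -> ps_agree (S k) (od2 (ps_parts c q n)) (od2 (ps_parts c' q' n))).
Proof.
  intros AqS. assert (Aq : ps_agree k q q') by (apply ps_agree_weaken with (2 := AqS); lia).
  induction n as [|n (H1 & H2 & H3 & H4)]; [repeat split; lia|].
  destruct (parts_agree n Aq) as (A1 & A2 & A3 & A4).
  destruct (parts_const_0 c q n Hc Hq) as (Z1 & Z2 & Z3 & Z4).
  destruct (parts_const_0 c' q' n Hc' Hq') as (Z1' & Z2' & Z3' & Z4').
  simpl power_parts; cbn [ev od ev2 od2].
  repeat split; intros Hn; apply ps_agree_add.
  - apply ps_agree_mult_S; auto; [apply Z1|apply Z1']; lia.
  - apply ps_agree_mult_l; auto.
  - apply H1; lia.
  - apply ps_agree_mult_S; auto; [apply Z2|apply Z2']; lia.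
  - apply ps_agree_mult_S; auto; [apply Z3|apply Z3']; lia.
  - apply H2; lia.
  - apply H3; lia.
  - apply ps_agree_mult_S; auto; [apply Z4|apply Z4']; lia.
Qed.

End PartsAgree.

(** * Real values of the parts and of their combinations *)

Lemma r_parts_bound C q eta n :
  0 < eta -> Rabs C <= eta -> Rabs q <= eta ^ 2 ->
  Rabs (ev (r_parts C q n)) <= (2 * eta) ^ n /\
  Rabs (od (r_parts C q n)) <= (2 * eta) ^ n / eta /\
  Rabs (ev2 (r_parts C q n)) <= (2 * eta) ^ n / eta ^ 2 /\
  Rabs (od2 (r_parts C q n)) <= (2 * eta) ^ n / eta ^ 3.
Proof.
  intros Heta HC Hq.
  (* The numbers are treated as constant series, so the bounds for series apply. *)
  assert (NC := norm_le_mono 1 _ _ _ HC (norm_le_const 1 C)).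
  assert (Nq := norm_le_mono 1 _ _ _ Hq (norm_le_const 1 q)).
  assert (Hx : Rabs 0 < 1) by (rewrite Rabs_R0; lra).
  destruct (norm_le_parts 1 _ _ eta n Heta NC Nq) as (H1 & H2 & H3 & H4).
  destruct (PSeries_parts 1 _ _ eta n 0 Heta NC Nq Hx) as (E1 & E2 & E3 & E4).
  rewrite !PSeries_ps_const in E1, E2, E3, E4.
  rewrite <- E1, <- E2, <- E3, <- E4.
  repeat split; apply (norm_le_PSeries 1); auto; lra.
Qed.

Lemma r_parts_plus C s n :
  ev (r_parts C (s ^ 2) n) + s * od (r_parts C (s ^ 2) n) = (C + s) ^ n.
Proof.
  induction n as [|n IH]; cbn [power_parts ev od]; [simpl; ring|].
  rewrite <- (tech_pow_Rmult (C + s)), <- IH. ring.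
Qed.

Lemma r_parts_minus C s n :
  ev (r_parts C (s ^ 2) n) - s * od (r_parts C (s ^ 2) n) = (C - s) ^ n.
Proof.
  induction n as [|n IH]; cbn [power_parts ev od]; [simpl; ring|].
  rewrite <- (tech_pow_Rmult (C - s)), <- IH. ring.
Qed.

Lemma r_parts_center C q n :
  ev (r_parts C q n) = C ^ n + q * ev2 (r_parts C q n) /\
  od (r_parts C q n) = INR n * C ^ pred n + q * od2 (r_parts C q n).
Proof.
  induction n as [|n [IH1 IH2]]; cbn [power_parts ev od ev2 od2]; [simpl; split; ring|].
  split.
  - rewrite IH1, <- tech_pow_Rmult. ring.
  - rewrite IH1, IH2, S_INR, Nat.pred_succ.
    assert (E : INR n * C ^ n = C * (INR n * C ^ pred n)) by (destruct n; simpl; ring).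
    rewrite Rmult_plus_distr_r, E. ring.
Qed.

(** For [q = s ^ 2], [ev] and [od] give the [E] and [D] in [f (C + s) = E + s * D] and
    [f (C - s) = E - s * D]; they depend on [s] only through [q]. *)
Definition rcomb (pr : parts R -> R) (C q : R) (f : nat -> R) : R :=
  Series (fun n => f n * pr (r_parts C q n)).

Lemma Series_trunc m f p :
  (0 < m)%nat -> ex_series (fun n => f n * p n) ->
  Series (fun n => ps_trunc m f n * p n) =
  Series (fun n => f n * p n) - sum_f_R0 (fun n => f n * p n) (pred m).
Proof.
  intros Hm Hex.
  assert (Hz : forall n, (m <= n)%nat -> ps_trunc m f n * p n = f n * p n).
  { intros n Hn. now rewrite ps_trunc_ge. }
  rewrite (Series_incr_n (fun n => f n * p n) m Hm Hex).
  rewrite (Series_incr_n (fun n => ps_trunc m f n * p n) m Hm).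
  - rewrite (sum_eq _ (fun _ => 0)).
    + rewrite sum_eq_R0 by auto.
      rewrite (Series_ext _ (fun k => f (m + k)%nat * p (m + k)%nat)); [ring|].
      intros k. apply Hz; lia.
    + intros i Hi. rewrite ps_trunc_lt by lia. ring.
  - apply (ex_series_incr_n _ m).
    apply ex_series_ext with (fun k => f (m + k)%nat * p (m + k)%nat).
    + intros k. symmetry. apply Hz; lia.
    + now apply (ex_series_incr_n (fun n => f n * p n) m).
Qed.

Section RealParts.

Variables (C q eta : R).
Hypothesis eta_pos : 0 < eta.
Hypothesis HC : Rabs C <= eta.
Hypothesis Hq : 0 <= q <= eta ^ 2.

Lemma ex_series_rcomb f K :
  norm_le (2 * eta) f K ->
  ex_series (fun n => f n * ev (r_parts C q n)) /\
  ex_series (fun n => f n * od (r_parts C q n)) /\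
  ex_series (fun n => f n * ev2 (r_parts C q n)) /\
  ex_series (fun n => f n * od2 (r_parts C q n)).
Proof.
  intros Hf.
  assert (Hq' : Rabs q <= eta ^ 2) by (rewrite Rabs_pos_eq; lra).
  assert (Hgen : forall (pr : parts R -> R) B,
    (forall n, Rabs (pr (r_parts C q n)) <= (2 * eta) ^ n * B) ->
    ex_series (fun n => f n * pr (r_parts C q n))).
  { intros pr B HB.
    apply (ex_series_le (V := R_CompleteNormedModule))
      with (fun n => B * Rabs (f n * (2 * eta) ^ n)).
    - intros n. change norm with Rabs. rewrite !Rabs_mult.
      rewrite (Rabs_pos_eq ((2 * eta) ^ n)) by (apply pow_le; lra).
      apply Rle_trans with (Rabs (f n) * ((2 * eta) ^ n * B)); [|lra].
      apply Rmult_le_compat_l; [apply Rabs_pos|apply HB].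
    - apply (ex_series_scal (V := R_NormedModule) B), (abs_bound_ex _ _ Hf). }
  split; [|split; [|split]].
  - apply Hgen with 1. intros n. rewrite Rmult_1_r. now apply r_parts_bound.
  - apply Hgen with (/ eta). intros n. now apply r_parts_bound.
  - apply Hgen with (/ eta ^ 2). intros n. now apply r_parts_bound.
  - apply Hgen with (/ eta ^ 3). intros n. now apply r_parts_bound.
Qed.

Lemma PSeries_plus_minus s f K :
  q = s ^ 2 -> norm_le (2 * eta) f K ->
  PSeries f (C + s) = rcomb ev C q f + s * rcomb od C q f /\
  PSeries f (C - s) = rcomb ev C q f - s * rcomb od C q f.
Proof.
  intros Hs Hf. destruct (ex_series_rcomb f K Hf) as (E1 & E2 & _).
  unfold rcomb. rewrite <- Series_scal_l.
  rewrite <- Series_plus, <- Series_minus;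
    auto; try (apply (ex_series_scal (V := R_NormedModule) s); auto).
  split; apply Series_ext; intros n; rewrite Hs.
  - rewrite <- r_parts_plus. ring.
  - rewrite <- r_parts_minus. ring.
Qed.

Lemma rcomb_ev_center f K :
  norm_le (2 * eta) f K -> rcomb ev C q f = PSeries f C + q * rcomb ev2 C q f.
Proof.
  intros Hf. destruct (ex_series_rcomb f K Hf) as (E1 & E2 & E3 & E4).
  unfold rcomb. rewrite <- Series_scal_l.
  replace (PSeries f C) with
    (Series (fun n => f n * ev (r_parts C q n))
      - Series (fun n => q * (f n * ev2 (r_parts C q n))));
    [ring|].
  rewrite <- Series_minus; auto; [|apply (ex_series_scal (V := R_NormedModule) q); auto].
  apply Series_ext; intros n. rewrite (proj1 (r_parts_center C q n)). ring.
Qed.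

Lemma rcomb_od_center g K :
  norm_le (2 * eta) (PS_Int g) K ->
  rcomb od C q (PS_Int g) = PSeries g C + q * rcomb od2 C q (PS_Int g).
Proof.
  intros Hf. destruct (ex_series_rcomb _ K Hf) as (E1 & E2 & E3 & E4).
  set (f := PS_Int g) in *.
  assert (E5 := ex_series_scal (V := R_NormedModule) q _ E4).
  unfold rcomb. rewrite <- Series_scal_l.
  replace (PSeries g C) with
    (Series (fun n => f n * od (r_parts C q n))
      - Series (fun n => q * (f n * od2 (r_parts C q n))));
    [ring|].
  rewrite <- Series_minus by assumption.
  (* The term [n = 0] vanishes since [PS_Int g] has no constant term; after the shift the factor [n]
     of [n * C ^ (n - 1)] cancels the division in the coefficient of the primitive. *)
  rewrite Series_incr_1 by (now apply (ex_series_minus (V := R_NormedModule))).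
  unfold f at 1 2; simpl PS_Int. rewrite !Rmult_0_l, Rmult_0_r, Rminus_0_r, Rplus_0_l.
  apply Series_ext; intros n. rewrite (proj2 (r_parts_center C q (S n))).
  unfold f, PS_Int. rewrite Nat.pred_succ. field.
  apply not_0_INR; lia.
Qed.

End RealParts.
(** * The equations for the center and the width *)

Section ShockSeries.

Variables (P Q W G : nat -> R) (w1 w3 d0 rho K : R).
Hypothesis w1_pos : 0 < w1.
Hypothesis w3_pos : 0 < w3.
Hypothesis d0_pos : 0 < d0.
Hypothesis rho_pos : 0 < rho.
Hypothesis HP : norm_le rho P K.
Hypothesis HQ : norm_le rho Q K.
Hypothesis HW : norm_le rho W K.
Hypothesis HG : norm_le rho G K.

Definition comb (pr : parts (nat -> R) -> nat -> R) (c q : nat -> R) (m : nat) (f : nat -> R)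
    : nat -> R :=
  ps_comb (ps_trunc m f) (fun n => pr (ps_parts c q n)).

Definition ps_sub (a b : nat -> R) : nat -> R := ps_add a (ps_scal (-1) b).

(** Here [W] is the velocity without its affine part and [G], [P], [Q] are primitives of
    [rhobar], [rhobar * W], [rhobar * x]. The center of mass condition, divided by [q], is
    [od2 P - ev2 W * od G + q * ev2 W * od2 G - ev W * od2 G - od W * (od2 Q - c * od2 G) = 0],
    with linear part [- 2 * d0 * w3 * c] in [c]; the truncations remove that part. *)
Definition center_map (c q : nat -> R) : nat -> R :=
  ps_scal (/ (2 * d0 * w3))
   (ps_sub
     (ps_sub
       (ps_add
         (ps_sub
           (ps_sub (comb od2 c q 5 P)
             (PS_mult (comb ev2 c q 4 W) (comb od c q 1 G)))
           (ps_scal (3 * w3) (PS_mult c (comb od c q 2 G))))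
         (PS_mult q (PS_mult (comb ev2 c q 3 W) (comb od2 c q 3 G))))
       (PS_mult (comb ev c q 3 W) (comb od2 c q 3 G)))
     (PS_mult (comb od c q 3 W)
       (ps_sub (comb od2 c q 3 Q) (PS_mult c (comb od2 c q 3 G))))).

(** Solves [od W * (1 + w1 * u) = w1 ^ 2 * u], where [od W = w3 * (q + 3 * c ^ 2) + ...],
    for the leading [q]. *)
Definition width_map (c q : nat -> R) : nat -> R :=
  ps_sub
    (ps_scal (/ w3)
      (ps_sub
        (ps_sub (ps_scal (w1 ^ 2) ps_var)
          (ps_scal w1 (PS_mult ps_var (comb od c q 3 W))))
        (comb od c q 4 W)))
    (ps_scal 3 (PS_mult c c)).

(** One constant above all [K * (2 / rho) ^ m] with [m <= 5], the largest truncation index. *)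
Let L := K * (1 + 2 / rho) ^ 5.

(** Truncation at degree [m] gives [(2 * eta / rho) ^ m], and [j] divisions by [s] take back
    [eta ^ j]. The condition [j <= m] is why even parts of low order are taken of truncated
    series. *)
Lemma comb_weight m j f eta :
  (j <= m <= 5)%nat -> 0 < eta -> 2 * eta <= rho -> norm_le rho f K ->
  abs_bound (fun n => ps_trunc m f n * ((2 * eta) ^ n / eta ^ j)) (L * eta ^ (m - j)).
Proof.
  intros Hm HR HR2 Hf.
  assert (HK := norm_le_pos _ _ _ Hf).
  assert (Hb : 0 < 2 / rho) by (apply Rdiv_lt_0_compat; lra).
  assert (HRj : 0 < / eta ^ j) by (apply Rinv_0_lt_compat, pow_lt; lra).
  assert (H := norm_le_vanish m (2 * eta) rho _ K (ps_trunc_lt m f)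
    ltac:(lra) rho_pos (norm_le_trunc _ m _ _ Hf)).
  intros N. apply Rle_trans with
    (sum_f_R0 (fun n => Rabs (ps_trunc m f n * (2 * eta) ^ n)) N * / eta ^ j).
  - rewrite (Rmult_comm (sum_f_R0 _ N)), scal_sum. apply sum_Rle. intros n _.
    unfold Rdiv. rewrite <- Rmult_assoc, (Rabs_mult _ (/ eta ^ j)).
    rewrite (Rabs_pos_eq (/ eta ^ j)) by lra. lra.
  - apply Rle_trans with (K * (2 * eta / rho) ^ m * / eta ^ j).
    { apply Rmult_le_compat_r; [lra|apply H]. }
    replace (2 * eta / rho) with (2 / rho * eta) by (field; lra).
    rewrite Rpow_mult_distr.
    replace (eta ^ m) with (eta ^ (m - j) * eta ^ j) by (rewrite <- pow_add; f_equal; lia).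
    replace (K * ((2 / rho) ^ m * (eta ^ (m - j) * eta ^ j)) * / eta ^ j)
      with (K * (2 / rho) ^ m * eta ^ (m - j)) by (field; apply pow_nonzero; lra).
    apply Rmult_le_compat_r; [apply pow_le; lra|].
    apply Rmult_le_compat_l; [assumption|].
    apply Rle_trans with ((1 + 2 / rho) ^ m); [apply pow_incr; lra|].
    apply Rle_pow; [lra|lia].
Qed.

Section Ball.

Variables (eta r : R) (c q : nat -> R).
Hypothesis R_pos : 0 < eta.
Hypothesis R_rho : 2 * eta <= rho.
Hypothesis r_pos : 0 <= r.
Hypothesis Hc : norm_le r c eta.
Hypothesis Hq : norm_le r q (eta ^ 2).

Lemma norm_le_comb_ev m f : (m <= 5)%nat -> norm_le rho f K ->
  norm_le r (comb ev c q m f) (L * eta ^ m).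
Proof.
  intros Hm Hf.
  replace (eta ^ m) with (eta ^ (m - 0)) by (f_equal; lia).
  apply norm_le_comb with (fun n => (2 * eta) ^ n / eta ^ 0);
    [|apply comb_weight; auto; lia|assumption].
  intros n. unfold Rdiv. rewrite pow_O, Rinv_1, Rmult_1_r.
  apply (norm_le_parts r c q eta n); assumption.
Qed.

Lemma norm_le_comb_od m f : (1 <= m <= 5)%nat -> norm_le rho f K ->
  norm_le r (comb od c q m f) (L * eta ^ (m - 1)).
Proof.
  intros Hm Hf.
  apply norm_le_comb with (fun n => (2 * eta) ^ n / eta ^ 1); [|now apply comb_weight|assumption].
  intros n. rewrite pow_1. apply (norm_le_parts r c q eta n); assumption.
Qed.

Lemma norm_le_comb_ev2 m f : (2 <= m <= 5)%nat -> norm_le rho f K ->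
  norm_le r (comb ev2 c q m f) (L * eta ^ (m - 2)).
Proof.
  intros Hm Hf.
  apply norm_le_comb with (fun n => (2 * eta) ^ n / eta ^ 2); [|now apply comb_weight|assumption].
  intros n. apply (norm_le_parts r c q eta n); assumption.
Qed.

Lemma norm_le_comb_od2 m f : (3 <= m <= 5)%nat -> norm_le rho f K ->
  norm_le r (comb od2 c q m f) (L * eta ^ (m - 3)).
Proof.
  intros Hm Hf.
  apply norm_le_comb with (fun n => (2 * eta) ^ n / eta ^ 3); [|now apply comb_weight|assumption].
  intros n. apply (norm_le_parts r c q eta n); assumption.
Qed.

End Ball.

Lemma norm_le_sub r a b M N :
  norm_le r a M -> norm_le r b N -> norm_le r (ps_sub a b) (M + N).
Proof.
  intros Ha Hb. apply norm_le_add; [assumption|].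
  apply norm_le_mono with (Rabs (-1) * N); [rewrite Rabs_left; lra|].
  now apply norm_le_scal.
Qed.

Lemma comb_const_0 c q m f :
  c 0%nat = 0 -> q 0%nat = 0 ->
  ((1 <= m)%nat -> comb ev c q m f 0%nat = 0) /\
  ((2 <= m)%nat -> comb od c q m f 0%nat = 0) /\
  ((3 <= m)%nat -> comb ev2 c q m f 0%nat = 0) /\
  ((4 <= m)%nat -> comb od2 c q m f 0%nat = 0).
Proof.
  intros Hc Hq.
  repeat split; intros Hm; apply ps_comb_0; intros n;
    (destruct (Nat.lt_ge_cases n m) as [Hn|Hn]; [left; now apply ps_trunc_lt|right]);
    apply parts_const_0; auto; lia.
Qed.

Lemma comb_agree (pr : parts (nat -> R) -> nat -> R) k c q c' q' m f :
  (forall n, (m <= n)%nat ->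
    ps_agree k (pr (ps_parts c q n)) (pr (ps_parts c' q' n))) ->
  ps_agree k (comb pr c q m f) (comb pr c' q' m f).
Proof.
  intros H. apply ps_agree_comb. intros n.
  destruct (Nat.lt_ge_cases n m) as [Hn|Hn]; [left; now apply ps_trunc_lt|right; auto].
Qed.

Lemma ps_agree_sub k a a' b b' :
  ps_agree k a a' -> ps_agree k b b' -> ps_agree k (ps_sub a b) (ps_sub a' b').
Proof. intros H1 H2. now apply ps_agree_add; [|apply ps_agree_scal]. Qed.

Lemma center_map_const_0 c q :
  c 0%nat = 0 -> q 0%nat = 0 -> center_map c q 0%nat = 0.
Proof.
  intros Hc Hq. unfold center_map, ps_sub, ps_scal.
  rewrite !ps_add_at, !PS_mult_0, Hc, Hq.
  rewrite (proj2 (proj2 (proj2 (comb_const_0 c q 5 P Hc Hq)))) by lia.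
  rewrite (proj1 (proj2 (proj2 (comb_const_0 c q 4 W Hc Hq)))) by lia.
  rewrite (proj1 (comb_const_0 c q 3 W Hc Hq)) by lia.
  rewrite (proj1 (proj2 (comb_const_0 c q 3 W Hc Hq))) by lia.
  ring.
Qed.

Lemma width_map_const_0 c q :
  c 0%nat = 0 -> q 0%nat = 0 -> width_map c q 0%nat = 0.
Proof.
  intros Hc Hq. unfold width_map, ps_sub, ps_scal.
  rewrite !ps_add_at, !PS_mult_0, Hc.
  rewrite (proj1 (proj2 (comb_const_0 c q 4 W Hc Hq))) by lia.
  replace (ps_var 0%nat) with 0 by reflexivity. ring.
Qed.

(** Once the linear part in [c] is removed, [c] enters only through products that gain an order. A
    linear term in [q] survives, for instance in [od2] of degree 5, hence the stronger assumption on
    [q]. *)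
Lemma center_map_agree k c q c' q' :
  c 0%nat = 0 -> q 0%nat = 0 -> c' 0%nat = 0 -> q' 0%nat = 0 ->
  ps_agree k c c' -> ps_agree (S k) q q' ->
  ps_agree (S k) (center_map c q) (center_map c' q').
Proof.
  intros Hc Hq Hc' Hq' Ac AqS.
  assert (Aq : ps_agree k q q') by (apply ps_agree_weaken with (2 := AqS); lia).
  assert (A := fun n => parts_agree c q c' q' k Ac n Aq).
  assert (AS := fun n => parts_agree_S c q c' q' k Hc Hq Hc' Hq' Ac n AqS).
  assert (Z := fun m f => comb_const_0 c q m f Hc Hq).
  assert (Z' := fun m f => comb_const_0 c' q' m f Hc' Hq').
  assert (AG : forall m f, ps_agree k (comb od2 c q m f) (comb od2 c' q' m f)).
  { intros; apply comb_agree; intros; apply A. }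
  apply ps_agree_scal, ps_agree_sub; [apply ps_agree_sub; [apply ps_agree_add;
    [apply ps_agree_sub; [apply ps_agree_sub|]|]|]|].
  - apply comb_agree; intros n Hn. apply (AS n); lia.
  - apply ps_agree_mult_l; [apply (Z 4%nat); lia|apply (Z' 4%nat); lia| |].
    + apply comb_agree; intros n Hn. apply (AS n); lia.
    + apply comb_agree; intros n Hn. apply (A n).
  - apply ps_agree_scal, ps_agree_mult_S; auto; [apply (Z 2%nat); lia|apply (Z' 2%nat); lia|].
    apply comb_agree; intros n Hn. apply (A n).
  - apply ps_agree_mult_l; auto. apply ps_agree_mult; auto.
    apply comb_agree; intros n Hn. apply (A n).
  - apply ps_agree_mult_l; [apply (Z 3%nat); lia|apply (Z' 3%nat); lia| |apply AG].
    apply comb_agree; intros n Hn. apply (AS n); lia.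
  - apply ps_agree_mult_l; [apply (Z 3%nat); lia|apply (Z' 3%nat); lia| |].
    + apply comb_agree; intros n Hn. apply (AS n); lia.
    + apply ps_agree_sub; auto. apply ps_agree_mult; auto.
Qed.

(** Each term containing [c] or [q] is multiplied by the variable, has weight at least 3, or is
    [c * c], so an order is gained in both arguments. *)
Lemma width_map_agree k c q c' q' :
  c 0%nat = 0 -> q 0%nat = 0 -> c' 0%nat = 0 -> q' 0%nat = 0 ->
  ps_agree k c c' -> ps_agree k q q' ->
  ps_agree (S k) (width_map c q) (width_map c' q').
Proof.
  intros Hc Hq Hc' Hq' Ac Aq.
  apply ps_agree_sub; [apply ps_agree_scal, ps_agree_sub; [apply ps_agree_sub|]|].
  - apply ps_agree_refl.
  - apply ps_agree_scal, ps_agree_mult_l; auto using ps_agree_refl.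
    apply comb_agree; intros n Hn. now apply (parts_agree c q c' q' k Ac n Aq).
  - apply comb_agree; intros n Hn.
    apply (parts_agree_S_same c q c' q' k Hc Hq Hc' Hq' Ac n Aq); lia.
  - now apply ps_agree_scal, ps_agree_mult_S.
Qed.

Ltac norm_bound :=
  match goal with
  | H : norm_le ?r ?a _ |- norm_le ?r ?a _ => exact H
  | |- norm_le _ (PS_mult _ _) _ => apply norm_le_mult; norm_bound
  | |- norm_le _ (ps_scal _ _) _ => apply norm_le_scal; norm_bound
  | |- norm_le _ (ps_sub _ _) _ => apply norm_le_sub; norm_bound
  | |- norm_le _ (ps_add _ _) _ => apply norm_le_add; norm_bound
  end.

(** Every term has weight at least 2, which beats the size [eta / 4] allowed for [c] once [eta] is
    small. *)
Lemma norm_le_center_map eta r c q :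
  0 < eta <= 1 -> 2 * eta <= rho -> 0 <= r ->
  norm_le r c (eta / 4) -> norm_le r q (eta ^ 2) ->
  norm_le r (center_map c q) (/ (2 * d0 * w3) * (L + 5 * L ^ 2 + w3 * L) * eta ^ 2).
Proof.
  intros Heta Hrho Hr Hc4 Hq.
  assert (Hc : norm_le r c eta) by (apply norm_le_mono with (2 := Hc4); lra).
  assert (B1 := norm_le_comb_od2 eta r c q (proj1 Heta) Hrho Hr Hc Hq 5 P ltac:(lia) HP).
  assert (B2 := norm_le_comb_ev2 eta r c q (proj1 Heta) Hrho Hr Hc Hq 4 W ltac:(lia) HW).
  assert (B3 := norm_le_comb_od eta r c q (proj1 Heta) Hrho Hr Hc Hq 1 G ltac:(lia) HG).
  assert (B4 := norm_le_comb_od eta r c q (proj1 Heta) Hrho Hr Hc Hq 2 G ltac:(lia) HG).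
  assert (B5 := norm_le_comb_ev2 eta r c q (proj1 Heta) Hrho Hr Hc Hq 3 W ltac:(lia) HW).
  assert (B6 := norm_le_comb_od2 eta r c q (proj1 Heta) Hrho Hr Hc Hq 3 G ltac:(lia) HG).
  assert (B7 := norm_le_comb_ev eta r c q (proj1 Heta) Hrho Hr Hc Hq 3 W ltac:(lia) HW).
  assert (B8 := norm_le_comb_od eta r c q (proj1 Heta) Hrho Hr Hc Hq 3 W ltac:(lia) HW).
  assert (B9 := norm_le_comb_od2 eta r c q (proj1 Heta) Hrho Hr Hc Hq 3 Q ltac:(lia) HQ).
  assert (HL : 0 <= L) by (apply norm_le_pos in B6; simpl in B6; lra).
  clear Hc. simpl Nat.sub in *. rewrite ?pow_O, ?pow_1 in *.
  eapply norm_le_mono; [|unfold center_map; norm_bound].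
  assert (Hkap : 0 < / (2 * d0 * w3)) by (apply Rinv_0_lt_compat; nra).
  rewrite (Rabs_pos_eq (/ _)), (Rabs_pos_eq (3 * w3)) by lra.
  rewrite (Rmult_assoc (/ _)). apply Rmult_le_compat_l; [lra|].
  assert (E2 : 0 <= eta ^ 2) by (apply pow_le; lra).
  assert (E3 : eta ^ 3 <= eta ^ 2) by (simpl; nra).
  assert (HL2 : 0 <= L ^ 2) by (apply pow_le; lra).
  assert (F1 : L ^ 2 * eta ^ 3 <= L ^ 2 * eta ^ 2) by (apply Rmult_le_compat_l; lra).
  assert (F2 : 0 <= w3 * L * eta ^ 2) by (apply Rmult_le_pos; [apply Rmult_le_pos|]; lra).
  assert (F3 : 0 <= L ^ 2 * eta ^ 2) by (apply Rmult_le_pos; lra).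
  simpl pow in *. nra.
Qed.

(** The term [3 * c ^ 2] has the same weight as [q] and does not become relatively small with [eta];
    bounding [c] by [eta / 4] reduces it to [3 / 16 * eta ^ 2]. The radius [eta ^ 3] makes the
    source [w1 ^ 2 * u] of higher order. *)
Lemma norm_le_width_map eta r c q :
  0 < eta <= 1 -> 2 * eta <= rho -> r = eta ^ 3 ->
  norm_le r c (eta / 4) -> norm_le r q (eta ^ 2) ->
  norm_le r (width_map c q)
    (/ w3 * (w1 ^ 2 + w1 * L + L) * eta ^ 3 + 3 / 16 * eta ^ 2).
Proof.
  intros Heta Hrho Hreta Hc4 Hq.
  assert (Hr : 0 <= r) by (rewrite Hreta; apply pow_le; lra).
  assert (Hc : norm_le r c eta) by (apply norm_le_mono with (2 := Hc4); lra).
  assert (B1 := norm_le_comb_od eta r c q (proj1 Heta) Hrho Hr Hc Hq 3 W ltac:(lia) HW).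
  assert (B2 := norm_le_comb_od eta r c q (proj1 Heta) Hrho Hr Hc Hq 4 W ltac:(lia) HW).
  assert (HL : 0 <= L).
  { assert (H := norm_le_pos _ _ _ B1). simpl in H.
    assert (0 < eta * eta) by nra. nra. }
  assert (Hv := norm_le_var r Hr).
  clear Hc. simpl Nat.sub in *.
  eapply norm_le_mono; [|unfold width_map; norm_bound].
  assert (Hiw : 0 < / w3) by (now apply Rinv_0_lt_compat).
  rewrite (Rabs_pos_eq (/ w3)), (Rabs_pos_eq 3), (Rabs_pos_eq (w1 ^ 2)), (Rabs_pos_eq w1)
    by (try apply pow_le; lra).
  rewrite Hreta.
  apply Rplus_le_compat; [|lra].
  rewrite Rmult_assoc. apply Rmult_le_compat_l; [lra|].
  assert (E3 : 0 <= w1 * L * eta ^ 3).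
  { apply Rmult_le_pos; [apply Rmult_le_pos; lra|apply pow_le; lra]. }
  assert (E2 : 0 <= eta ^ 2 <= 1) by (simpl; nra).
  nra.
Qed.

Lemma shock_series :
  exists eta r c q,
    0 < eta /\ 2 * eta <= rho /\ 0 < r /\
    c 0%nat = 0 /\ norm_le r c (eta / 4) /\ q 0%nat = 0 /\ norm_le r q (eta ^ 2) /\
    (forall k, c k = center_map c q k) /\ (forall k, q k = width_map c q k).
Proof.
  assert (HK := norm_le_pos _ _ _ HP).
  assert (HL : 0 <= L).
  { unfold L. apply Rmult_le_pos; [assumption|]. apply pow_le.
    assert (0 < 2 / rho) by (apply Rdiv_lt_0_compat; lra). lra. }
  set (kap := / (2 * d0 * w3)).
  assert (Hkap : 0 < kap) by (apply Rinv_0_lt_compat; nra).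
  assert (Hiw : 0 < / w3) by (now apply Rinv_0_lt_compat).
  set (T1 := kap * (L + 5 * L ^ 2 + w3 * L)).
  set (T2 := / w3 * (w1 ^ 2 + w1 * L + L)).
  assert (HT1 : 0 <= T1) by (apply Rmult_le_pos; nra).
  assert (HT2 : 0 <= T2) by (apply Rmult_le_pos; nra).
  (* This forces [eta * T1 <= 1 / 4] and [eta * T2 <= 1 / 2], so that [T1 * eta ^ 2 <= eta / 4] and
     [T2 * eta ^ 3 + 3 / 16 * eta ^ 2 <= eta ^ 2]: both balls are invariant. *)
  set (eta := Rmin (rho / 2) (/ (4 * T1 + 2 * T2 + 1))).
  assert (HD : 0 < / (4 * T1 + 2 * T2 + 1)) by (apply Rinv_0_lt_compat; lra).
  assert (HR0 : 0 < eta) by (apply Rmin_glb_lt; lra).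
  assert (HRrho : 2 * eta <= rho).
  { assert (eta <= rho / 2) by apply Rmin_l. lra. }
  assert (HRT : eta * (4 * T1 + 2 * T2 + 1) <= 1).
  { apply Rle_trans with (/ (4 * T1 + 2 * T2 + 1) * (4 * T1 + 2 * T2 + 1)).
    - apply Rmult_le_compat_r; [lra|apply Rmin_r].
    - rewrite Rinv_l; lra. }
  assert (HR1 : eta <= 1) by nra.
  assert (HRT1 : eta * T1 <= 1 / 4) by nra.
  assert (HRT2 : eta * T2 <= 1 / 2) by nra.
  set (r := eta ^ 3). assert (Hr : 0 < r) by (now apply pow_lt).
  destruct (ps_fixed_point center_map width_map r (eta / 4) (eta ^ 2))
    as (c & q & Hball & E).
  - lra.
  - apply pow_le; lra.
  - intros c q [[Hc0 Hc] [Hq0 Hq]]. split; [now apply center_map_const_0|].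
    apply norm_le_mono with (T1 * eta ^ 2); [simpl; nra|].
    apply norm_le_center_map; auto; lra.
  - intros c q [[Hc0 Hc] [Hq0 Hq]]. split; [now apply width_map_const_0|].
    apply norm_le_mono with (T2 * eta ^ 3 + 3 / 16 * eta ^ 2).
    { assert (0 <= eta ^ 2) by (apply pow_le; lra).
      replace (T2 * eta ^ 3) with (eta * T2 * eta ^ 2) by ring. nra. }
    apply norm_le_width_map; auto; lra.
  - intros k a b a' b' [[Ha _] [Hb _]] [[Ha' _] [Hb' _]].
    now apply center_map_agree.
  - intros k a b a' b' [[Ha _] [Hb _]] [[Ha' _] [Hb' _]].
    now apply width_map_agree.
  - exists eta, r, c, q. destruct Hball as [[Hc0 Hc] [Hq0 Hq]].
    do 7 (split; [assumption|]). split; intros k; apply E.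
Qed.

Section Evaluation.

Variables (eta r : R) (c q : nat -> R) (x : R).
Hypothesis eta_pos : 0 < eta.
Hypothesis eta_rho : 2 * eta <= rho.
Hypothesis Hc : norm_le r c eta.
Hypothesis Hq : norm_le r q (eta ^ 2).
Hypothesis Hx : Rabs x < r.

Let C := PSeries c x.
Let q_ := PSeries q x.

Lemma PSeries_comb_parts m f :
  norm_le rho f K -> (m <= 5)%nat ->
  PSeries (comb ev c q m f) x = rcomb ev C q_ (ps_trunc m f) /\
  ((1 <= m)%nat -> PSeries (comb od c q m f) x = rcomb od C q_ (ps_trunc m f)) /\
  ((2 <= m)%nat -> PSeries (comb ev2 c q m f) x = rcomb ev2 C q_ (ps_trunc m f)) /\
  ((3 <= m)%nat -> PSeries (comb od2 c q m f) x = rcomb od2 C q_ (ps_trunc m f)).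
Proof.
  intros Hf Hm. assert (Hx' := Rlt_le _ _ Hx).
  assert (HN := fun n => norm_le_parts r c q eta n eta_pos Hc Hq).
  assert (HP' := fun n => PSeries_parts r c q eta n x eta_pos Hc Hq Hx).
  assert (Gen : forall (pr : parts (nat -> R) -> nat -> R) (pr' : parts R -> R) j,
    (j <= m)%nat ->
    (forall n, norm_le r (pr (ps_parts c q n)) ((2 * eta) ^ n / eta ^ j)) ->
    (forall n, PSeries (pr (ps_parts c q n)) x = pr' (r_parts C q_ n)) ->
    PSeries (comb pr c q m f) x = rcomb pr' C q_ (ps_trunc m f)).
  { intros pr pr' j Hj H1 H2. unfold comb, rcomb.
    rewrite (PSeries_comb r _ _ _ _ H1
      (comb_weight m j f eta (conj Hj Hm) eta_pos eta_rho Hf) x Hx').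
    apply Series_ext. intros n. now rewrite H2. }
  split; [|split; [|split]].
  - apply (Gen ev ev 0%nat); try lia; intros n; [|apply HP'].
    unfold Rdiv. rewrite pow_O, Rinv_1, Rmult_1_r. apply HN.
  - intros Hj. apply (Gen od od 1%nat); try lia; intros n; [|apply HP'].
    rewrite pow_1. apply HN.
  - intros Hj. apply (Gen ev2 ev2 2%nat); try lia; intros n; [apply HN|apply HP'].
  - intros Hj. apply (Gen od2 od2 3%nat); try lia; intros n; [apply HN|apply HP'].
Qed.

End Evaluation.

End ShockSeries.

(** * Evaluation of convergent series without explicit bounds *)

Definition ps_conv (r : R) (a : nat -> R) : Prop := exists M, norm_le r a M.

Lemma ps_conv_add r a b : ps_conv r a -> ps_conv r b -> ps_conv r (ps_add a b).
Proof. intros [M HM] [N HN]. eexists; apply norm_le_add; eassumption. Qed.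

Lemma ps_conv_sub r a b : ps_conv r a -> ps_conv r b -> ps_conv r (ps_sub a b).
Proof. intros [M HM] [N HN]. eexists; apply norm_le_sub; eassumption. Qed.

Lemma ps_conv_mult r a b : ps_conv r a -> ps_conv r b -> ps_conv r (PS_mult a b).
Proof. intros [M HM] [N HN]. eexists; apply norm_le_mult; eassumption. Qed.

Lemma ps_conv_scal r k a : ps_conv r a -> ps_conv r (ps_scal k a).
Proof. intros [M HM]. eexists; apply norm_le_scal; eassumption. Qed.

Lemma ps_conv_const r k : ps_conv r (ps_const k).
Proof. eexists; apply norm_le_const. Qed.

Lemma ps_conv_var r : 0 <= r -> ps_conv r ps_var.
Proof. intros Hr; eexists; now apply norm_le_var. Qed.

Lemma PSeries_conv_add r a b x : Rabs x < r -> ps_conv r a -> ps_conv r b ->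
  PSeries (ps_add a b) x = PSeries a x + PSeries b x.
Proof. intros Hx [M HM] [N HN]. apply (PSeries_ps_add r _ _ M N); auto; lra. Qed.

Lemma PSeries_conv_mult r a b x : Rabs x < r -> ps_conv r a -> ps_conv r b ->
  PSeries (PS_mult a b) x = PSeries a x * PSeries b x.
Proof. intros Hx [M HM] [N HN]. now apply (PSeries_ps_mult r _ _ M N). Qed.

Lemma PSeries_conv_sub r a b x : Rabs x < r -> ps_conv r a -> ps_conv r b ->
  PSeries (ps_sub a b) x = PSeries a x - PSeries b x.
Proof.
  intros Hx Ha Hb. unfold ps_sub.
  rewrite (PSeries_conv_add r), PSeries_ps_scal; auto using ps_conv_scal. ring.
Qed.

Ltac conv := repeat first
  [ assumption | apply ps_conv_sub | apply ps_conv_add | apply ps_conv_mult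
  | apply ps_conv_scal | apply ps_conv_const | apply ps_conv_var ].

Ltac eval_series r := repeat first
  [ rewrite PSeries_ps_scal | rewrite PSeries_ps_var | rewrite PSeries_ps_const
  | rewrite (PSeries_conv_sub r) by conv
  | rewrite (PSeries_conv_add r) by conv
  | rewrite (PSeries_conv_mult r) by conv ].

Lemma rcomb_trunc_vanish pr C q m f :
  (forall n, (n < m)%nat -> f n * pr (r_parts C q n) = 0) ->
  rcomb pr C q (ps_trunc m f) = rcomb pr C q f.
Proof.
  intros H. apply Series_ext. intros n.
  destruct (Nat.lt_ge_cases n m) as [Hn|Hn].
  - rewrite ps_trunc_lt, H by assumption. ring.
  - now rewrite ps_trunc_ge.
Qed.

(** Apart from the source, every term is of second order in the variable. The coefficient is the
    value of [q / u] at 0; its positivity is what makes the square root of [q / u] analytic. *)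
Lemma width_first_order W w1 w3 c q :
  c 0%nat = 0 -> q 0%nat = 0 ->
  width_map W w1 w3 c q 1%nat = / w3 * w1 ^ 2.
Proof.
  intros Hc Hq.
  assert (M1 : forall a b, PS_mult a b 1%nat = a 0%nat * b 1%nat + a 1%nat * b 0%nat)
    by reflexivity.
  assert (Hparts : forall n, ((3 <= n)%nat -> ev (ps_parts c q n) 1%nat = 0) /\
    ((4 <= n)%nat -> od (ps_parts c q n) 1%nat = 0)).
  { induction n as [|n [IH1 IH2]]; [split; lia|].
    destruct (parts_const_0 c q n Hc Hq) as (Z1 & Z2 & _).
    cbn [power_parts ev od]. rewrite !ps_add_at, !M1, Hc, Hq.
    split; intros Hn; rewrite Z2 by lia.
    - rewrite Z1 by lia. ring.
    - rewrite IH1 by lia. ring. }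
  assert (Hcomb : comb od c q 4 W 1%nat = 0).
  { unfold comb, ps_comb. rewrite (Series_ext _ (fun n => 0 * 0)).
    - rewrite Series_scal_l; ring.
    - intros n. destruct (Nat.lt_ge_cases n 4) as [Hn|Hn].
      + rewrite ps_trunc_lt by assumption. ring.
      + rewrite (proj2 (Hparts n)) by assumption. ring. }
  unfold width_map, ps_sub, ps_scal.
  rewrite !ps_add_at, !M1, Hcomb, Hc.
  rewrite (proj1 (proj2 (comb_const_0 c q 3 W Hc Hq))) by lia.
  replace (ps_var 0%nat) with 0 by reflexivity. replace (ps_var 1%nat) with 1 by reflexivity.
  ring.
Qed.

(** * Center, width and jumps for a given density and velocity *)

Section Profile.

Variables (d W : nat -> R) (w1 rho K : R).
Let G := PS_Int d.
Let P := PS_Int (PS_mult d W).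
Let Q := PS_Int (PS_mult ps_var d).
Hypothesis w1_pos : 0 < w1.
Hypothesis w3_pos : 0 < W 3%nat.
Hypothesis d0_pos : 0 < d 0%nat.
Hypothesis W_flat : forall n, (n < 3)%nat -> W n = 0.
Hypothesis rho_pos : 0 < rho.
Hypothesis Hd : norm_le rho d K.
Hypothesis HW : norm_le rho W K.
Hypothesis HG : norm_le rho G K.
Hypothesis HP : norm_le rho P K.
Hypothesis HQ : norm_le rho Q K.

Lemma P_coef n : (n < 4)%nat -> P n = 0.
Proof.
  intros Hn. unfold P, PS_Int. destruct n as [|n]; [reflexivity|].
  unfold PS_mult. rewrite sum_eq_R0; [unfold Rdiv; ring|].
  intros i Hi. rewrite (W_flat (n - i)) by lia. ring.
Qed.

Lemma P_coef_4 : P 4%nat = d 0%nat * W 3%nat / 4.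
Proof.
  unfold P, PS_Int, PS_mult. simpl sum_f_R0. simpl Nat.sub.
  rewrite (W_flat 0), (W_flat 1), (W_flat 2) by lia. simpl INR. field.
Qed.

Section AtPoint.

Variables (C q eta : R).
Hypothesis eta_pos : 0 < eta.
Hypothesis eta_rho : 2 * eta <= rho.
Hypothesis HC : Rabs C <= eta.
Hypothesis Hq : 0 <= q <= eta ^ 2.

Notation T pr m f := (rcomb pr C q (ps_trunc m f)).
Notation A := (rcomb ev C q W).
Notation B := (rcomb od C q W).

(** With [F] the left-hand side of the reduced momentum balance, the hypothesis on [C]
    says [F = 0] with the linear part of [F] moved to the left; the full balance is [q * F]. *)
Lemma momentum_balance :
  C = / (2 * d 0%nat * W 3%nat) *
    (T od2 5 P - T ev2 4 W * T od 1 G - 3 * W 3%nat * (C * T od 2 G)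
     + q * (T ev2 3 W * T od2 3 G) - T ev 3 W * T od2 3 G
     - T od 3 W * (T od2 3 Q - C * T od2 3 G)) ->
  rcomb od C q P - A * rcomb od C q G
    - B * (rcomb od C q Q - C * rcomb od C q G) = 0.
Proof.
  assert (Hsh : forall f, norm_le rho f K -> norm_le (2 * eta) f K).
  { intros f. apply norm_le_shrink; lra. }
  assert (HC' : Rabs C <= rho) by lra.
  destruct (ex_series_rcomb C q eta eta_pos HC Hq _ _ (Hsh _ HP)) as (_ & _ & _ & XP).
  destruct (ex_series_rcomb C q eta eta_pos HC Hq _ _ (Hsh _ HW)) as (_ & _ & XW & _).
  destruct (ex_series_rcomb C q eta eta_pos HC Hq _ _ (Hsh _ HG)) as (_ & XG & _).
  (* The parts removed by truncation: [4 * C] times [P 4] gives [d0 * w3 * C], and [ev2 W]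
     contributes [3 * w3 * C], multiplied by [d0] in the balance. Together they make the linear part
     [(1 - 3) * d0 * w3 * C]. *)
  assert (TP : T od2 5 P = rcomb od2 C q P - d 0%nat * W 3%nat * C).
  { unfold rcomb at 1. rewrite (Series_trunc 5 P) by (auto; lia). fold (rcomb od2 C q P).
    cbn [Init.Nat.pred sum_f_R0].
    rewrite (P_coef 0), (P_coef 1), (P_coef 2), (P_coef 3), P_coef_4 by lia.
    cbn [power_parts ev od ev2 od2]. field. }
  assert (TW4 : T ev2 4 W = rcomb ev2 C q W - 3 * W 3%nat * C).
  { unfold rcomb at 1. rewrite (Series_trunc 4 W) by (auto; lia). fold (rcomb ev2 C q W).
    cbn [Init.Nat.pred sum_f_R0]. rewrite (W_flat 0), (W_flat 1), (W_flat 2) by lia.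
    cbn [power_parts ev od ev2 od2]. ring. }
  assert (TG2 : T od 2 G = rcomb od C q G - d 0%nat).
  { unfold rcomb at 1. rewrite (Series_trunc 2 G) by (auto; lia). fold (rcomb od C q G).
    cbn [Init.Nat.pred sum_f_R0]. unfold G at 2 3; simpl PS_Int.
    cbn [power_parts ev od ev2 od2]. field. }
  assert (TG1 : T od 1 G = rcomb od C q G).
  { apply rcomb_trunc_vanish. intros n Hn. replace n with 0%nat by lia.
    unfold G; simpl PS_Int. ring. }
  assert (Tod2 : forall f, T od2 3 f = rcomb od2 C q f).
  { intros f. apply rcomb_trunc_vanish. intros n Hn.
    destruct n as [|[|[|n]]]; [| | |lia]; cbn [power_parts ev od ev2 od2]; ring. }
  assert (TW : forall pr, T pr 3 W = rcomb pr C q W).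
  { intros pr. apply rcomb_trunc_vanish. intros n Hn. rewrite W_flat by assumption. ring. }
  rewrite TP, TW4, TG2, TG1, !Tod2, !TW. clear TP TW4 TG2 TG1 Tod2 TW.
  (* The values at the center cancel in the balance, because there [P' = W * G'] and [Q' = C * G'];
     only multiples of [q] remain. *)
  assert (EP := rcomb_od_center C q eta eta_pos HC Hq _ _ (Hsh _ HP)).
  assert (EQ := rcomb_od_center C q eta eta_pos HC Hq _ _ (Hsh _ HQ)).
  assert (EG := rcomb_od_center C q eta eta_pos HC Hq _ _ (Hsh _ HG)).
  assert (EW := rcomb_ev_center C q eta eta_pos HC Hq _ _ (Hsh _ HW)).
  assert (HCrho : Rabs C < rho) by lra.
  rewrite (PSeries_conv_mult rho) in EP by (assumption || (eexists; eassumption)).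
  rewrite (PSeries_conv_mult rho), PSeries_ps_var in EQ
    by (assumption || (apply ps_conv_var; lra) || (eexists; eassumption)).
  fold P in EP. fold Q in EQ. fold G in EG.
  intros HF.
  assert (HF' : rcomb od2 C q P - rcomb ev2 C q W * rcomb od C q G
     + q * (rcomb ev2 C q W * rcomb od2 C q G) - A * rcomb od2 C q G
     - B * (rcomb od2 C q Q - C * rcomb od2 C q G) = 0).
  { apply (f_equal (Rmult (2 * d 0%nat * W 3%nat))) in HF.
    rewrite <- Rmult_assoc, Rinv_r in HF by (apply Rmult_integral_contrapositive; split; lra).
    lra. }
  apply (f_equal (Rmult q)) in HF'.
  rewrite EP, EQ, EW, EG in *.
  lra.
Qed.

Lemma slope_balance x :
  q = / W 3%nat * (w1 ^ 2 * x - w1 * (x * T od 3 W) - T od 4 W) - 3 * (C * C) ->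
  B * (1 + w1 * x) = w1 ^ 2 * x.
Proof.
  destruct (ex_series_rcomb C q eta eta_pos HC Hq W K) as (_ & XW & _).
  { apply norm_le_shrink with (2 := HW); lra. }
  assert (TW4 : T od 4 W = B - W 3%nat * (3 * C ^ 2 + q)).
  { unfold rcomb at 1. rewrite (Series_trunc 4 W) by (auto; lia). fold (rcomb od C q W).
    cbn [Init.Nat.pred sum_f_R0]. rewrite (W_flat 0), (W_flat 1), (W_flat 2) by lia.
    cbn [power_parts ev od ev2 od2]. ring. }
  assert (TW : T od 3 W = rcomb od C q W).
  { apply rcomb_trunc_vanish. intros n Hn. rewrite W_flat by assumption. ring. }
  rewrite TW4, TW. intros H. apply (f_equal (Rmult (W 3%nat))) in H.
  rewrite Rmult_minus_distr_l, <- Rmult_assoc, Rinv_r in H by lra. lra.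
Qed.

End AtPoint.

Lemma shock_profile :
  exists eta r c q A B M,
    0 < eta /\ 2 * eta <= rho /\ 0 < r /\
    c 0%nat = 0 /\ q 0%nat = 0 /\ q 1%nat = / W 3%nat * w1 ^ 2 /\ M 0%nat = d 0%nat /\
    ps_conv r c /\ ps_conv r q /\ ps_conv r A /\ ps_conv r B /\ ps_conv r M /\
    forall x s, Rabs x < r -> 0 <= s -> PSeries q x = s ^ 2 ->
      let C := PSeries c x in
      let jump f := PSeries f (C + s) - PSeries f (C - s) in
      Rabs C <= eta /\ s <= eta /\
      PSeries W (C + s) = PSeries A x + s * PSeries B x /\
      PSeries W (C - s) = PSeries A x - s * PSeries B x /\
      PSeries B x * (1 + w1 * x) = w1 ^ 2 * x /\
      jump G = 2 * s * PSeries M x /\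
      jump P - PSeries A x * jump G - PSeries B x * (jump Q - C * jump G) = 0.
Proof.
  destruct (shock_series P Q W G w1 (W 3%nat) (d 0%nat) rho K)
    as (eta & r & c & q & Heta & Hrho & Hr & Hc0 & Hc4 & Hq0 & Hq & Ec & Eq); auto.
  assert (Hc : norm_le r c eta) by (apply norm_le_mono with (2 := Hc4); lra).
  assert (Hr' := Rlt_le _ _ Hr).
  assert (Cev : forall m f, norm_le rho f K -> (m <= 5)%nat -> ps_conv r (comb ev c q m f)).
  { intros m f Hf Hm. eexists. now apply (norm_le_comb_ev rho K rho_pos eta). }
  assert (Cod : forall m f, norm_le rho f K -> (1 <= m <= 5)%nat -> ps_conv r (comb od c q m f)).
  { intros m f Hf Hm. eexists. now apply (norm_le_comb_od rho K rho_pos eta). }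
  assert (Cev2 : forall m f, norm_le rho f K -> (2 <= m <= 5)%nat -> ps_conv r (comb ev2 c q m f)).
  { intros m f Hf Hm. eexists. now apply (norm_le_comb_ev2 rho K rho_pos eta). }
  assert (Cod2 : forall m f, norm_le rho f K -> (3 <= m <= 5)%nat -> ps_conv r (comb od2 c q m f)).
  { intros m f Hf Hm. eexists. now apply (norm_le_comb_od2 rho K rho_pos eta). }
  assert (Eval := fun x (Hx : Rabs x < r) m f =>
    PSeries_comb_parts rho K rho_pos eta r c q x Heta Hrho Hc Hq Hx m f).
  exists eta, r, c, q, (comb ev c q 3 W), (comb od c q 3 W), (comb od c q 1 G).
  assert (X1 : ps_conv r c) by (eexists; eassumption).
  assert (X2 : ps_conv r q) by (eexists; eassumption).
  assert (X3 := Cev 3%nat W HW ltac:(lia)). assert (X4 := Cod 3%nat W HW ltac:(lia)).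
  assert (X5 := Cod 1%nat G HG ltac:(lia)). assert (X6 := Cod 2%nat G HG ltac:(lia)).
  assert (X7 := Cod 4%nat W HW ltac:(lia)). assert (X8 := Cev2 4%nat W HW ltac:(lia)).
  assert (X9 := Cev2 3%nat W HW ltac:(lia)). assert (X10 := Cod2 3%nat G HG ltac:(lia)).
  assert (X11 := Cod2 3%nat Q HQ ltac:(lia)). assert (X12 := Cod2 5%nat P HP ltac:(lia)).
  assert (TG1 : forall C q, rcomb od C q (ps_trunc 1 G) = rcomb od C q G).
  { intros C q'. apply rcomb_trunc_vanish. intros n Hn. replace n with 0%nat by lia.
    unfold G; simpl PS_Int. ring. }
  assert (TW : forall pr C q, rcomb pr C q (ps_trunc 3 W) = rcomb pr C q W).
  { intros pr C q'. apply rcomb_trunc_vanish. intros n Hn. rewrite W_flat by assumption. ring. }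
  do 5 (split; [assumption|]). split; [|split].
  - rewrite Eq. now apply width_first_order.
  (* At 0 both [c] and [q] vanish, and the odd part of [G] reduces to [G'] at 0, the density
     there. *)
  - assert (Hx : Rabs 0 < r) by (rewrite Rabs_R0; lra).
    rewrite <- PSeries_0.
    rewrite (proj1 (proj2 (Eval 0 Hx 1%nat G HG ltac:(lia)))) by lia.
    rewrite TG1, !PSeries_0, Hc0, Hq0.
    unfold G. rewrite (rcomb_od_center 0 0 eta Heta) with (K := K).
    + rewrite PSeries_0. ring.
    + rewrite Rabs_R0; lra.
    + split; [lra|apply pow_le; lra].
    + apply norm_le_shrink with (2 := HG); lra.
  - do 5 (split; [assumption|]). intros x s Hx Hs Hqs C jump.
    assert (HC : Rabs C <= eta) by (apply (norm_le_PSeries r); auto; lra).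
    assert (Hqx := norm_le_PSeries r _ _ x (Rlt_le _ _ Hx) Hq).
    rewrite Hqs in Hqx. rewrite Rabs_pos_eq in Hqx by (now apply pow_le).
    assert (Hse : s <= eta) by (apply Rsqr_incr_0_var; [rewrite !Rsqr_pow2; assumption|lra]).
    set (q' := PSeries q x) in *.
    assert (Hq' : 0 <= q' <= eta ^ 2) by (rewrite Hqs; split; [now apply pow_le|assumption]).
    assert (Hsh : forall f, norm_le rho f K -> norm_le (2 * eta) f K).
    { intros f. apply norm_le_shrink; lra. }
    assert (PM := fun f Hf => PSeries_plus_minus C q' eta Heta HC Hq' s f K Hqs (Hsh f Hf)).
    assert (EA : PSeries (comb ev c q 3 W) x = rcomb ev C q' W).
    { rewrite (proj1 (Eval x Hx 3%nat W HW ltac:(lia))). apply TW. }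
    assert (EB : PSeries (comb od c q 3 W) x = rcomb od C q' W).
    { rewrite (proj1 (proj2 (Eval x Hx 3%nat W HW ltac:(lia)))) by lia. apply TW. }
    assert (EM : PSeries (comb od c q 1 G) x = rcomb od C q' G).
    { rewrite (proj1 (proj2 (Eval x Hx 1%nat G HG ltac:(lia)))) by lia. apply TG1. }
    destruct (PM W HW) as [PW1 PW2]. destruct (PM G HG) as [PG1 PG2].
    destruct (PM P HP) as [PP1 PP2]. destruct (PM Q HQ) as [PQ1 PQ2].
    split; [assumption|]. split; [assumption|].
    split; [now rewrite PW1, EA, EB|]. split; [now rewrite PW2, EA, EB|].
    split.
    { rewrite EB. apply (slope_balance C q' eta Heta Hrho HC Hq').
      transitivity (PSeries (width_map W w1 (W 3%nat) c q) x).
      { apply PSeries_ext, Eq. }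
      unfold width_map. eval_series r. fold C.
      rewrite (proj1 (proj2 (Eval x Hx 3%nat W HW ltac:(lia)))) by lia.
      rewrite (proj1 (proj2 (Eval x Hx 4%nat W HW ltac:(lia)))) by lia.
      reflexivity. }
    unfold jump. split.
    { rewrite PG1, PG2, EM. ring. }
    rewrite EA, EB, PG1, PG2, PP1, PP2, PQ1, PQ2.
    assert (E := momentum_balance C q' eta Heta Hrho HC Hq').
    enough (E0 : rcomb od C q' P - rcomb ev C q' W * rcomb od C q' G -
      rcomb od C q' W * (rcomb od C q' Q - C * rcomb od C q' G) = 0).
    { apply (f_equal (Rmult (2 * s))) in E0. lra. }
    apply E.
    transitivity (PSeries (center_map P Q W G (W 3%nat) (d 0%nat) c q) x).
    { apply PSeries_ext, Ec. }
    unfold center_map. eval_series r. fold C. fold q'.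
    rewrite (proj2 (proj2 (proj2 (Eval x Hx 5%nat P HP ltac:(lia))))) by lia.
    rewrite (proj1 (proj2 (proj2 (Eval x Hx 4%nat W HW ltac:(lia))))) by lia.
    rewrite (proj1 (proj2 (Eval x Hx 1%nat G HG ltac:(lia)))) by lia.
    rewrite (proj1 (proj2 (Eval x Hx 2%nat G HG ltac:(lia)))) by lia.
    rewrite (proj1 (proj2 (proj2 (Eval x Hx 3%nat W HW ltac:(lia))))) by lia.
    rewrite (proj2 (proj2 (proj2 (Eval x Hx 3%nat G HG ltac:(lia))))) by lia.
    rewrite (proj1 (Eval x Hx 3%nat W HW ltac:(lia))).
    rewrite (proj1 (proj2 (Eval x Hx 3%nat W HW ltac:(lia)))) by lia.
    rewrite (proj2 (proj2 (proj2 (Eval x Hx 3%nat Q HQ ltac:(lia))))) by lia.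
    reflexivity.
Qed.

End Profile.

(** * From the profile to the solution *)

Section PointMass.

Variables (rhobar w G P Q W C q A B y : R -> R) (om0 om1 w3 t0 r delta delta1 : R).

Let s t := sqrt (q (t - t0)).
Let x1 t := C (t - t0) - s t.
Let x2 t := C (t - t0) + s t.
Let phi t x := x + t * w x.

Hypothesis om1_pos : 0 < om1.
Hypothesis w3_pos : 0 < w3.
Hypothesis t0_eq : t0 = 1 / om1.
Hypothesis r_pos : 0 < r.
Hypothesis delta_lt : 0 < delta < delta1.
Hypothesis G_deriv : forall x, Rabs x < r -> is_derive G x (rhobar x).
Hypothesis Q_deriv : forall x, Rabs x < r -> is_derive Q x (x * rhobar x).
Hypothesis P_deriv : forall x, Rabs x < r -> is_derive P x (rhobar x * W x).
Hypothesis rhobar_cont : forall x, Rabs x < r -> continuous rhobar x.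
Hypothesis w_deriv : forall x, Rabs x < r -> ex_derive w x.
Hypothesis w_eq : forall x, Rabs x < r -> w x = om0 - om1 * x + W x.
Hypothesis w_slope : forall x, Rabs x < r -> 2 * w3 * x ^ 2 <= Derive w x + om1.
Hypothesis C_deriv : forall u, 0 < u < delta1 -> ex_derive C u.
Hypothesis q_deriv : forall u, 0 < u < delta1 -> ex_derive q u.
Hypothesis q_lower : forall u, 0 < u < delta1 -> 3 / 4 * (om1 ^ 2 / w3) * u <= q u.
Hypothesis C_small : forall u, 0 < u < delta1 -> Rabs (C u) <= sqrt (q u) / 8.
Hypothesis inside : forall u, 0 < u < delta1 -> Rabs (C u) + sqrt (q u) < r.
Hypothesis spread : forall u v, 0 < u <= v -> v < delta1 ->
  Rabs (C v - C u) <= sqrt (q v) - sqrt (q u).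
Hypothesis W_right : forall u, 0 < u < delta1 ->
  W (C u + sqrt (q u)) = A u + sqrt (q u) * B u.
Hypothesis W_left : forall u, 0 < u < delta1 ->
  W (C u - sqrt (q u)) = A u - sqrt (q u) * B u.
Hypothesis slope_eq : forall u, 0 < u < delta1 -> B u * (1 + om1 * u) = om1 ^ 2 * u.
Hypothesis balance : forall u, 0 < u < delta1 ->
  let jump f := f (C u + sqrt (q u)) - f (C u - sqrt (q u)) in
  jump P - A u * jump G - B u * (jump Q - C u * jump G) = 0.
Hypothesis y_eq : forall t, t0 < t < t0 + delta1 ->
  y t = t * (om0 + A (t - t0) - B (t - t0) * C (t - t0)).
Hypothesis y_deriv : forall t, t0 < t < t0 + delta1 -> ex_derive y t.

Lemma t0_om1 : t0 * om1 = 1.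
Proof. rewrite t0_eq. field. lra. Qed.

Lemma q_pos u : 0 < u < delta1 -> 0 < q u.
Proof.
  intros Hu. apply Rlt_le_trans with (2 := q_lower u Hu).
  assert (0 < om1 ^ 2 / w3) by (apply Rdiv_lt_0_compat; [apply pow_lt|]; assumption).
  nra.
Qed.

Lemma ends t : t0 < t < t0 + delta1 ->
  0 < s t /\ Rabs (C (t - t0)) <= s t / 8 /\ - r < x1 t < 0 /\ 0 < x2 t < r.
Proof.
  intros Ht. assert (Hu : 0 < t - t0 < delta1) by lra.
  assert (Hs : 0 < s t) by (apply sqrt_lt_R0, q_pos; assumption).
  assert (HC := C_small _ Hu). assert (Hi := inside _ Hu).
  change (sqrt (q (t - t0))) with (s t) in HC, Hi.
  split; [assumption|]. split; [assumption|].
  unfold x1, x2. assert (H := Rabs_pos (C (t - t0))).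
  destruct (Rabs_le_between (C (t - t0)) (s t / 8)) as [H1 _].
  destruct (Rabs_le_between (C (t - t0)) (Rabs (C (t - t0)))) as [H2 _].
  specialize (H1 HC). specialize (H2 (Rle_refl _)). lra.
Qed.

Lemma slope_time t : t0 < t < t0 + delta1 -> t * B (t - t0) = om1 * t - 1.
Proof.
  intros Ht. assert (Hu : 0 < t - t0 < delta1) by lra.
  apply (Rmult_eq_reg_l om1); [|lra].
  replace (om1 * (om1 * t - 1)) with (om1 ^ 2 * (t - t0)).
  - rewrite <- slope_eq by assumption.
    replace (om1 * (t * B (t - t0))) with (B (t - t0) * (om1 * t)) by ring.
    f_equal. rewrite Rmult_minus_distr_l, (Rmult_comm om1 t0), t0_om1. ring.
  - replace (om1 ^ 2 * (t - t0)) with (om1 * (om1 * t - t0 * om1)) by ring.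
    now rewrite t0_om1.
Qed.

Lemma ends_meet t : t0 < t < t0 + delta1 -> phi t (x1 t) = y t /\ phi t (x2 t) = y t.
Proof.
  intros Ht. assert (Hu : 0 < t - t0 < delta1) by lra.
  destruct (ends t Ht) as (_ & _ & H1 & H2).
  assert (EB := slope_time t Ht).
  unfold phi. rewrite y_eq by assumption.
  rewrite !w_eq by (apply Rabs_def1; lra).
  unfold x1, x2, s. rewrite W_left, W_right by assumption.
  (* The positions of the two ends differ by [2 s] times this expression. *)
  assert (E : 1 - om1 * t + t * B (t - t0) = 0) by lra.
  set (sq := sqrt (q (t - t0))).
  split.
  - apply (f_equal (Rmult (C (t - t0) - sq))) in E. lra.
  - apply (f_equal (Rmult (C (t - t0) + sq))) in E. lra.
Qed.

Lemma slope_before t x :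
  0 <= t <= t0 -> Rabs x < r -> t < t0 \/ x <> 0 -> 0 < 1 + t * Derive w x.
Proof.
  intros Ht Hx Hor. assert (Hs := w_slope x Hx). assert (E := t0_om1).
  assert (Ht0 : 0 < t0) by nra.
  assert (Hx2 : 0 <= x ^ 2) by apply pow2_ge_0.
  assert (Htd : t * (2 * w3 * x ^ 2 - om1) <= t * Derive w x) by (apply Rmult_le_compat_l; lra).
  assert (Hwx : 0 <= w3 * x ^ 2) by (apply Rmult_le_pos; lra).
  assert (0 <= t * (w3 * x ^ 2)) by (apply Rmult_le_pos; lra).
  destruct Hor as [Hlt|Hx0]; [nra|].
  destruct (Rle_lt_or_eq_dec t t0 (proj2 Ht)) as [Hlt| ->]; [nra|].
  assert (0 < x ^ 2) by (apply pow2_gt_0; assumption).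
  assert (0 < t0 * (w3 * x ^ 2)) by (apply Rmult_lt_0_compat; [lra|apply Rmult_lt_0_compat; lra]).
  nra.
Qed.

(** A free particle has [Rabs x >= 7 / 8 * s], so [2 * w3 * x ^ 2 >= 2 * (49 / 64) * (3 / 4) * om1 ^
    2 * u], and the numerical factor [147 / 128] exceeds 1. With [z = om1 * u] this gives [1 + t *
    w' > 1 + (1 + z) * (z - 1) = z ^ 2]. Asymptotically the factor would be 3; the constants 2, 3/4
    and 1/8 in the hypotheses spend this room. *)
Lemma slope_after t x :
  t0 < t < t0 + delta1 -> Rabs x < r -> x <= x1 t \/ x2 t <= x -> 0 < 1 + t * Derive w x.
Proof.
  intros Ht Hx Hor. assert (Hs := w_slope x Hx). assert (E := t0_om1).
  destruct (ends t Ht) as (Hs0 & HC & _). apply Rabs_le_between in HC.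
  assert (Hu : 0 < t - t0 < delta1) by lra.
  assert (Hq := q_lower _ Hu).
  assert (Hs2 : s t ^ 2 = q (t - t0)) by (apply pow2_sqrt; left; now apply q_pos).
  assert (Hx2 : (7 / 8 * s t) ^ 2 <= x ^ 2).
  { unfold x1, x2 in Hor. destruct Hor; simpl; nra. }
  assert (Hq' : 3 / 4 * (om1 ^ 2) * (t - t0) <= w3 * q (t - t0)).
  { apply (Rmult_le_compat_l w3) in Hq; [|lra].
    replace (w3 * (3 / 4 * (om1 ^ 2 / w3) * (t - t0)))
      with (3 / 4 * om1 ^ 2 * (t - t0)) in Hq by (field; lra). exact Hq. }
  assert (Ht0 : 0 < t0) by nra.
  assert (Hwx : 49 / 64 * (w3 * q (t - t0)) <= w3 * x ^ 2).
  { rewrite <- Hs2. nra. }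
  assert (Hpos : 0 < om1 ^ 2 * (t - t0)) by (apply Rmult_lt_0_compat; [apply pow_lt|]; lra).
  assert (H1 : om1 ^ 2 * (t - t0) < 2 * w3 * x ^ 2) by lra.
  assert (H2 : t * (om1 ^ 2 * (t - t0) - om1) < t * Derive w x)
    by (apply Rmult_lt_compat_l; lra).
  replace (t * (om1 ^ 2 * (t - t0) - om1)) with
    (om1 * t * (om1 * t - t0 * om1 - 1)) in H2 by ring.
  rewrite E in H2.
  assert (1 < om1 * t) by nra. nra.
Qed.

Lemma phi_increasing t a b :
  - r < a -> a < b -> b < r ->
  (forall x, a < x < b -> 0 < 1 + t * Derive w x) -> phi t a < phi t b.
Proof.
  intros Ha Hab Hb H.
  destruct (MVT_cor2 (phi t) (fun x => 1 + t * Derive w x) a b Hab) as (z & Hz & Hzab).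
  - intros x Hx. apply is_derive_Reals.
    assert (Hw : ex_derive w x) by (apply w_deriv, Rabs_def1; lra).
    unfold phi. auto_derive; [assumption|]. ring_simplify. reflexivity.
  - specialize (H z Hzab). nra.
Qed.

Definition unabsorbed (t x : R) : Prop :=
  Rabs x < r /\ (t0 < t -> x < x1 t \/ x2 t < x).

Lemma phi_lt t a b :
  0 <= t < t0 + delta1 -> unabsorbed t a -> unabsorbed t b -> a < b ->
  phi t a < phi t b.
Proof.
  intros Ht [Ha Ha'] [Hb Hb'] Hab.
  apply Rabs_def2 in Ha. apply Rabs_def2 in Hb.
  destruct (Rle_or_lt t t0) as [Hle|Hgt].
  - assert (Hneq : forall a b, - r < a -> a < b -> b < r -> (b <= 0 \/ 0 <= a) ->
      phi t a < phi t b).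
    { intros a' b' H1 H2 H3 H4. apply phi_increasing; auto. intros x Hx.
      apply slope_before; [lra|apply Rabs_def1; lra|right; lra]. }
    (* At [t = t0] the slope vanishes at 0, so an interval containing 0 is cut there. *)
    destruct (Rle_or_lt b 0) as [Hb0|Hb0]; [apply Hneq; lra|].
    destruct (Rle_or_lt 0 a) as [Ha0|Ha0]; [apply Hneq; lra|].
    apply Rlt_trans with (phi t 0); apply Hneq; lra.
  - assert (Ht' : t0 < t < t0 + delta1) by lra.
    destruct (ends t Ht') as (_ & _ & H1 & H2).
    destruct (ends_meet t Ht') as [E1 E2].
    assert (Hneq : forall a b, - r < a -> a < b -> b < r -> (b <= x1 t \/ x2 t <= a) ->
      phi t a < phi t b).
    { intros a' b' K1 K2 K3 K4. apply phi_increasing; auto. intros x Hx.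
      apply slope_after; [assumption|apply Rabs_def1; lra|destruct K4; [left|right]; lra]. }
    specialize (Ha' Hgt). specialize (Hb' Hgt).
    destruct (Rle_or_lt b (x1 t)) as [Hb1|Hb1]; [apply Hneq; lra|].
    destruct (Rle_or_lt (x2 t) a) as [Ha2|Ha2]; [apply Hneq; lra|].
    (* Here the absorbed interval lies between [a] and [b], and both its ends are sent to [y t]. *)
    apply Rlt_trans with (y t).
    + rewrite <- E1. apply Hneq; lra.
    + rewrite <- E2. apply Hneq; lra.
Qed.

Lemma phi_injective t a b :
  0 <= t < t0 + delta1 -> unabsorbed t a -> unabsorbed t b ->
  phi t a = phi t b -> a = b.
Proof.
  intros Ht Ha Hb E. destruct (Rtotal_order a b) as [H|[H|H]]; [|assumption|].
  - assert (H' := phi_lt t a b Ht Ha Hb H). lra.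
  - assert (H' := phi_lt t b a Ht Hb Ha H). lra.
Qed.

Lemma unabsorbed_off_mass t x :
  t0 < t < t0 + delta1 -> unabsorbed t x -> phi t x <> y t.
Proof.
  intros Ht [Hx Hx']. destruct (ends t Ht) as (_ & _ & H1 & H2).
  destruct (ends_meet t Ht) as [E1 E2]. apply Rabs_def2 in Hx.
  destruct (Hx' (proj1 Ht)) as [Hlt|Hlt].
  - enough (phi t x < phi t (x1 t)) by lra.
    apply phi_increasing; try lra. intros z Hz.
    apply slope_after; [assumption|apply Rabs_def1; lra|left; lra].
  - enough (phi t (x2 t) < phi t x) by lra.
    apply phi_increasing; try lra. intros z Hz.
    apply slope_after; [assumption|apply Rabs_def1; lra|right; lra].
Qed.

Lemma ends_deriv t : t0 < t < t0 + delta1 -> ex_derive x1 t /\ ex_derive x2 t.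
Proof.
  intros Ht. assert (Hu : 0 < t - t0 < delta1) by lra.
  unfold x1, x2, s.
  split; auto_derive; repeat split; auto using C_deriv, q_deriv, q_pos.
Qed.

Lemma is_derive_jump f df t : t0 < t < t0 + delta1 ->
  (forall x, Rabs x < r -> is_derive f x (df x)) ->
  is_derive (fun t => f (x2 t) - f (x1 t)) t
    (Derive x2 t * df (x2 t) - Derive x1 t * df (x1 t)).
Proof.
  intros Ht Hf. destruct (ends t Ht) as (_ & _ & H1 & H2).
  destruct (ends_deriv t Ht) as [D1 D2].
  apply (is_derive_minus (V := R_NormedModule)).
  - apply (is_derive_comp f x2); [apply Hf, Rabs_def1; lra|now apply Derive_correct].
  - apply (is_derive_comp f x1); [apply Hf, Rabs_def1; lra|now apply Derive_correct].
Qed.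

Let momentum x := om0 * G x - om1 * Q x + P x.

Lemma momentum_deriv x : Rabs x < r -> is_derive momentum x (rhobar x * w x).
Proof.
  intros Hx. unfold momentum.
  replace (rhobar x * w x)
    with (om0 * rhobar x - om1 * (x * rhobar x) + rhobar x * W x)
    by (rewrite w_eq by assumption; ring).
  apply (is_derive_plus (V := R_NormedModule)); [|now apply P_deriv].
  apply (is_derive_minus (V := R_NormedModule)).
  - apply (is_derive_scal G x om0); now apply G_deriv.
  - apply (is_derive_scal Q x om1); now apply Q_deriv.
Qed.

(** The point mass sits at the center of mass of the particles it has absorbed. *)
Lemma center_of_mass t : t0 < t < t0 + delta1 ->
  Q (x2 t) - Q (x1 t) + t * (momentum (x2 t) - momentum (x1 t))
    - y t * (G (x2 t) - G (x1 t)) = 0.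
Proof.
  intros Ht. assert (Hu : 0 < t - t0 < delta1) by lra.
  assert (HB := balance _ Hu). cbv zeta in HB.
  change (sqrt (q (t - t0))) with (s t) in HB.
  change (C (t - t0) + s t) with (x2 t) in HB. change (C (t - t0) - s t) with (x1 t) in HB.
  assert (EB := slope_time t Ht).
  rewrite y_eq by assumption. unfold momentum.
  apply (f_equal (Rmult t)) in HB.
  assert (E : 1 - om1 * t + t * B (t - t0) = 0) by lra.
  apply (f_equal (Rmult (Q (x2 t) - Q (x1 t)))) in E. lra.
Qed.

(** This is the time derivative of [center_of_mass]. The motion of the ends contributes [Derive x_i
    t * rhobar (x_i) * (x_i + t * w (x_i) - y)], which vanishes by [ends_meet]. *)
Lemma momentum_conserved t : t0 < t < t0 + delta1 ->
  (G (x2 t) - G (x1 t)) * Derive y t = momentum (x2 t) - momentum (x1 t).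
Proof.
  intros Ht.
  pose (H := fun t => Q (x2 t) - Q (x1 t) + t * (momentum (x2 t) - momentum (x1 t))
    - y t * (G (x2 t) - G (x1 t))).
  assert (H0 : is_derive H t 0).
  { apply is_derive_ext_loc with (fun _ => 0); [|apply (is_derive_const (V := R_NormedModule))].
    assert (Heps : 0 < Rmin (t - t0) (t0 + delta1 - t)) by (apply Rmin_glb_lt; lra).
    exists (mkposreal _ Heps). intros t' Ht'. symmetry. apply center_of_mass.
    apply Rabs_def2 in Ht'. simpl in Ht'.
    assert (A1 := Rmin_l (t - t0) (t0 + delta1 - t)).
    assert (A2 := Rmin_r (t - t0) (t0 + delta1 - t)).
    unfold minus, plus, opp in Ht'; simpl in Ht'. lra. }
  assert (JQ := is_derive_jump Q _ t Ht Q_deriv).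
  assert (JG := is_derive_jump G _ t Ht G_deriv).
  assert (JM := is_derive_jump momentum _ t Ht momentum_deriv).
  assert (Jy := Derive_correct _ _ (y_deriv t Ht)).
  assert (JtM := is_derive_mult (fun t => t) _ t _ _ (is_derive_id t) JM Rmult_comm).
  assert (JyG := is_derive_mult y _ t _ _ Jy JG Rmult_comm).
  assert (JH := is_derive_minus _ _ t _ _ (is_derive_plus _ _ t _ _ JQ JtM) JyG).
  apply is_derive_unique in JH. apply is_derive_unique in H0.
  assert (JH' : 0 =
    (Derive x2 t * (x2 t * rhobar (x2 t)) - Derive x1 t * (x1 t * rhobar (x1 t)))
    + (1 * (momentum (x2 t) - momentum (x1 t))
      + t * (Derive x2 t * (rhobar (x2 t) * w (x2 t)) - Derive x1 t * (rhobar (x1 t) * w (x1 t))))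
    - (Derive y t * (G (x2 t) - G (x1 t))
      + y t * (Derive x2 t * rhobar (x2 t) - Derive x1 t * rhobar (x1 t)))).
  { rewrite <- H0. exact JH. }
  destruct (ends_meet t Ht) as [E1 E2]. unfold phi in E1, E2.
  apply (f_equal (Rmult (Derive x1 t * rhobar (x1 t)))) in E1.
  apply (f_equal (Rmult (Derive x2 t * rhobar (x2 t)))) in E2.
  lra.
Qed.

Lemma point_mass_of_profile :
  exists rho v, point_mass_solution rhobar w t0 delta r rho v x1 x2 y
    (fun t => G (x2 t) - G (x1 t)).
Proof.
  (* The inverse of the flow on unabsorbed particles; its value is arbitrary at positions that no
     such particle reaches. *)
  pose (X := fun t z => epsilon (inhabits 0) (fun x => unabsorbed t x /\ phi t x = z)).
  assert (HX : forall t x, 0 <= t < t0 + delta1 -> unabsorbed t x -> X t (phi t x) = x).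
  { intros t x Ht Hx.
    destruct (epsilon_spec (inhabits 0) (fun z => unabsorbed t z /\ phi t z = phi t x))
      as [H1 H2]; [now exists x|]. now apply (phi_injective t). }
  pose (v := fun t z => if excluded_middle_informative (t0 < t /\ z = y t)
    then Derive y t else w (X t z)).
  exists (fun t z => rhobar (X t z) / (1 + t * Derive w (X t z))), v.
  assert (Hfree : forall t x, 0 <= t < t0 + delta1 -> unabsorbed t x ->
    v t (x + t * w x) = w x).
  { intros t x Ht Hx. unfold v. destruct (excluded_middle_informative _) as [[H1 H2]|_].
    - exfalso. apply (unabsorbed_off_mass t x) in H2; auto; lra.
    - change (x + t * w x) with (phi t x). now rewrite HX. }
  assert (Ht0 : 0 < t0) by (rewrite t0_eq; apply Rdiv_lt_0_compat; lra).
  split.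
  - intros t x Ht Hx Hor.
    assert (Hun : unabsorbed t x) by (split; [assumption|lra]).
    split; [now apply slope_before|]. split; [apply Hfree; [lra|assumption]|].
    cbv beta. change (x + t * w x) with (phi t x). rewrite HX by (lra || assumption).
    reflexivity.
  - intros t Ht. destruct (ends t) as (H1 & H2 & H3 & H4); lra.
  - intros t Ht. apply ends_meet; lra.
  - intros t Ht. apply ends_meet; lra.
  - intros t x Ht Hx Hor.
    assert (Hun : unabsorbed t x) by (split; [assumption|auto]).
    split; [apply slope_after; [lra|assumption|destruct Hor; [left|right]; lra]|].
    split; [apply Hfree; [lra|assumption]|].
    cbv beta. change (x + t * w x) with (phi t x). rewrite HX by (lra || assumption).
    reflexivity.
  - intros t' t x Ht' Ht Hx Hor.
    (* The center moves less than the half-width grows, so the absorbed intervals are nested. *)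
    assert (Hsp := spread (t' - t0) (t - t0) ltac:(lra) ltac:(lra)).
    change (sqrt (q (t - t0))) with (s t) in Hsp.
    change (sqrt (q (t' - t0))) with (s t') in Hsp.
    apply Rabs_le_between in Hsp.
    unfold x1, x2 in *. destruct Hor; [left|right]; lra.
  - intros t Ht. split; [apply y_deriv; lra|].
    unfold v. destruct (excluded_middle_informative _) as [_|H]; [reflexivity|].
    exfalso; apply H; split; [lra|reflexivity].
  - intros t Ht. destruct (ends t) as (H1 & H2 & H3 & H4); [lra|].
    apply (is_RInt_derive (V := R_CompleteNormedModule) G rhobar);
      rewrite Rmin_left, Rmax_right by lra; intros z Hz;
      [apply G_deriv|apply rhobar_cont]; apply Rabs_def1; lra.
  - intros t Ht. destruct (ends t) as (H1 & H2 & H3 & H4); [lra|].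
    rewrite momentum_conserved by lra.
    apply (is_RInt_derive (V := R_CompleteNormedModule) momentum (fun xi => rhobar xi * w xi));
      rewrite Rmin_left, Rmax_right by lra; intros z Hz;
      assert (Hz' : Rabs z < r) by (apply Rabs_def1; lra).
    + now apply momentum_deriv.
    + apply (continuous_mult (K := R_AbsRing)); [now apply rhobar_cont|].
      now apply (ex_derive_continuous (V := R_NormedModule)), w_deriv.
Qed.

End PointMass.

(** * Choice of the neighbourhoods *)

Lemma continuous_PSeries_0 a : Rbar_lt 0 (CV_radius a) -> continuous (PSeries a) 0.
Proof.
  intros Ha. apply continuity_pt_filterlim, PSeries_continuity. now rewrite Rabs_R0.
Qed.

Lemma locally_PSeries_lt a c :
  Rbar_lt 0 (CV_radius a) -> a 0%nat < c -> locally 0 (fun x => PSeries a x < c).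
Proof.
  intros Ha Hc. apply (continuous_PSeries_0 a Ha (fun z => z < c)).
  apply open_lt. now rewrite PSeries_0.
Qed.

Lemma locally_PSeries_gt a c :
  Rbar_lt 0 (CV_radius a) -> c < a 0%nat -> locally 0 (fun x => c < PSeries a x).
Proof.
  intros Ha Hc. apply (continuous_PSeries_0 a Ha (fun z => c < z)).
  apply open_gt. now rewrite PSeries_0.
Qed.

Lemma ps_conv_radius r a : 0 < r -> ps_conv r a -> Rbar_lt 0 (CV_radius a).
Proof.
  intros Hr [M HM]. rewrite <- Rabs_R0. apply (norm_le_inside r a M); [|assumption].
  now rewrite Rabs_R0.
Qed.

Lemma radius_ps_conv a :
  Rbar_lt 0 (CV_radius a) -> exists r, 0 < r /\ ps_conv r a.
Proof.
  intros Ha. destruct (CV_radius a) as [l| |] eqn:El; simpl in Ha; [| |easy].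
  - exists (l / 2). split; [lra|]. apply inside_norm_le; [lra|]. rewrite El. simpl; lra.
  - exists 1. split; [lra|]. apply inside_norm_le; [lra|]. now rewrite El.
Qed.

Lemma ps_conv_shrink r r' a : 0 <= r' <= r -> ps_conv r a -> ps_conv r' a.
Proof. intros Hr [M HM]. exists M. now apply norm_le_shrink with r. Qed.

Lemma expansion_radius f a c :
  expansion_at f a c ->
  Rbar_lt 0 (CV_radius c) /\ locally a (fun x => f x = PSeries c (x - a)).
Proof.
  intros [eps H]. split.
  - assert (He := cond_pos eps).
    apply Rbar_lt_le_trans with (eps / 2); [simpl; lra|].
    apply Rbar_not_lt_le. intros Hlt.
    specialize (H (a + eps / 2)).
    replace (a + eps / 2 - a) with (eps / 2) in H by ring.
    apply (CV_disk_outside c (eps / 2)).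
    + rewrite Rabs_pos_eq by lra. exact Hlt.
    + apply ex_series_lim_0. apply ex_pseries_R. eexists. apply H.
      apply Rabs_def1; unfold minus, plus, opp; simpl; lra.
  - exists eps. intros x Hx. symmetry. apply is_pseries_unique. now apply H.
Qed.

Lemma PS_derive_Int a k : PS_derive (PS_Int a) k = a k.
Proof. unfold PS_derive, PS_Int. field. apply not_0_INR; lia. Qed.

Lemma is_derive_PS_Int r a x :
  ps_conv r a -> Rabs x < r -> is_derive (PSeries (PS_Int a)) x (PSeries a x).
Proof.
  intros [M HM] Hx.
  rewrite <- (PSeries_ext _ _ x (PS_derive_Int a)). apply is_derive_PSeries.
  rewrite CV_radius_Int. now apply norm_le_inside with r M.
Qed.

Lemma ps_conv_Int r r' a : 0 <= r' < r -> ps_conv r a -> ps_conv r' (PS_Int a).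
Proof.
  intros Hr [M HM]. apply inside_norm_le; [lra|]. rewrite CV_radius_Int.
  rewrite <- (Rabs_pos_eq r') by lra. apply norm_le_inside with r M; [|assumption].
  rewrite Rabs_pos_eq; lra.
Qed.

Lemma ex_derive_ps_conv r a x : ps_conv r a -> Rabs x < r -> ex_derive (PSeries a) x.
Proof. intros [M HM] Hx. apply ex_derive_PSeries. now apply norm_le_inside with r M. Qed.

Lemma locally_PSeries_abs_lt a c :
  Rbar_lt 0 (CV_radius a) -> Rabs (a 0%nat) < c -> locally 0 (fun x => Rabs (PSeries a x) < c).
Proof.
  intros Ha Hc. apply Rabs_def2 in Hc.
  apply filter_imp with (fun x => PSeries a x < c /\ - c < PSeries a x).
  - intros x [H1 H2]. now apply Rabs_def1.
  - apply filter_and; [apply locally_PSeries_lt|apply locally_PSeries_gt]; tauto.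
Qed.

Lemma derive_increment f df a b :
  a < b -> (forall x, a <= x <= b -> is_derive f x (df x)) ->
  exists z, a < z < b /\ f b - f a = df z * (b - a).
Proof.
  intros Hab Hf. destruct (MVT_cor2 f df a b Hab) as (z & Hz & Hzab).
  - intros x Hx. now apply is_derive_Reals, Hf.
  - now exists z.
Qed.

(** Here [c] is of order [u] but [sqrt q] of order [sqrt u], so for small [u] the half-width
    dominates the center in size and in growth. *)
Lemma admissible_times c q rs kap r :
  0 < r -> ps_conv r c -> ps_conv r q -> 0 < rs -> 0 < kap ->
  c 0%nat = 0 -> q 0%nat = 0 -> q 1%nat = kap ->
  exists delta1, 0 < delta1 <= r /\
    (forall u, 0 < u < delta1 ->
      3 / 4 * kap * u <= PSeries q u /\
      Rabs (PSeries c u) <= sqrt (PSeries q u) / 8 /\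
      Rabs (PSeries c u) + sqrt (PSeries q u) < rs) /\
    (forall u v, 0 < u <= v -> v < delta1 ->
      Rabs (PSeries c v - PSeries c u) <= sqrt (PSeries q v) - sqrt (PSeries q u)).
Proof.
  intros Hr Hc Hq Hrs Hkap Hc0 Hq0 Hq1.
  assert (Rc := ps_conv_radius r c Hr Hc). assert (Rq := ps_conv_radius r q Hr Hq).
  pose (c1 := PS_decr_1 c). pose (q1 := PS_decr_1 q).
  assert (Rc1 : Rbar_lt 0 (CV_radius c1)) by (unfold c1; now rewrite CV_radius_decr_1).
  assert (Rq1 : Rbar_lt 0 (CV_radius q1)) by (unfold q1; now rewrite CV_radius_decr_1).
  assert (Ec : forall x, PSeries c x = x * PSeries c1 x).
  { intros x. now apply PSeries_decr_1_aux. }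
  assert (Eq : forall x, PSeries q x = x * PSeries q1 x).
  { intros x. now apply PSeries_decr_1_aux. }
  set (L1 := Rabs (c1 0%nat) + 1).
  assert (HL1 : 0 < L1) by (assert (H := Rabs_pos (c1 0%nat)); unfold L1; lra).
  (* With both roots below [sg], their sum is at most [kap / (2 * L1)]. As [q] grows at rate at
     least [kap / 2], the roots grow at rate at least [L1], which bounds the speed of [c]. *)
  set (sg := Rmin (rs / 2) (kap / (4 * L1))).
  assert (Hsg : 0 < sg) by (apply Rmin_glb_lt; [lra|apply Rdiv_lt_0_compat; lra]).
  assert (Hsg2 : 0 < sg ^ 2) by (now apply pow_lt).
  (* The bound [kap / (100 * L1 ^ 2)] gives [(u * L1) ^ 2 <= kap * u / 100 <= q / 75], below
     [(sqrt q / 8) ^ 2 = q / 64]. *)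
  assert (Hev : locally 0 (fun x =>
    (Rabs x < r /\ Rabs x < kap / (100 * L1 ^ 2)) /\
    (3 / 4 * kap < PSeries q1 x /\ Rabs (PSeries c1 x) < L1) /\
    (Rabs (PSeries c x) < rs / 2 /\ PSeries q x < sg ^ 2) /\
    (Rabs (PSeries (PS_derive c) x) < L1 /\ kap / 2 < PSeries (PS_derive q) x))).
  { assert (Hid : forall e, 0 < e -> locally 0 (fun x => Rabs x < e)).
    { intros e He. exists (mkposreal e He). intros x Hx.
      unfold ball in Hx; simpl in Hx. unfold AbsRing_ball, abs, minus, plus, opp in Hx; simpl in Hx.
      now rewrite Ropp_0, Rplus_0_r in Hx. }
    repeat apply filter_and.
    - now apply Hid.
    - apply Hid, Rdiv_lt_0_compat; [assumption|]. assert (0 < L1 ^ 2) by (now apply pow_lt). lra.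
    - apply locally_PSeries_gt; [assumption|]. change (q1 0%nat) with (q 1%nat). lra.
    - apply locally_PSeries_abs_lt; [assumption|]. unfold L1; lra.
    - apply locally_PSeries_abs_lt; [assumption|]. rewrite Hc0, Rabs_R0; lra.
    - apply locally_PSeries_lt; [assumption|]. now rewrite Hq0.
    - apply locally_PSeries_abs_lt; [now rewrite CV_radius_derive|].
      unfold PS_derive; simpl INR. rewrite Rmult_1_l. change (c 1%nat) with (c1 0%nat).
      unfold L1; lra.
    - apply locally_PSeries_gt; [now rewrite CV_radius_derive|].
      unfold PS_derive; simpl INR. lra. }
  destruct Hev as [eps Hev].
  assert (Hev' : forall x, 0 < x < eps -> _) by (intros x Hx; refine (Hev x _);
    apply Rabs_def1; unfold minus, plus, opp; simpl; lra).
  clear Hev.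
  assert (Hsq : forall u, 0 < u < eps -> 0 < PSeries q u /\ 0 < sqrt (PSeries q u) < sg).
  { intros u Hu. destruct (Hev' u Hu) as (_ & (H1 & _) & (_ & H2) & _).
    assert (Hqu : 0 < PSeries q u) by (rewrite Eq; apply Rmult_lt_0_compat; lra).
    split; [assumption|]. split; [now apply sqrt_lt_R0|].
    rewrite <- (sqrt_pow2 sg) by lra. apply sqrt_lt_1_alt. lra. }
  assert (Heps := cond_pos eps).
  exists (Rmin eps r). split; [split; [apply Rmin_glb_lt; lra|apply Rmin_r]|].
  assert (Hmin := Rmin_l eps r).
  split.
  - intros u Hu. assert (Hu' : 0 < u < eps) by lra.
    destruct (Hev' u Hu') as ((_ & Hur) & (H1 & H2) & (H3 & _) & _).
    destruct (Hsq u Hu') as [Hqu Hsu].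
    assert (Hlow : 3 / 4 * kap * u <= PSeries q u) by (rewrite Eq; nra).
    split; [assumption|]. split.
    + rewrite Rabs_pos_eq in Hur by lra.
      assert (HL2 : 0 < L1 ^ 2) by (now apply pow_lt).
      assert (Hu1 : u * (100 * L1 ^ 2) < kap).
      { apply (Rmult_lt_compat_r (100 * L1 ^ 2)) in Hur; [|lra].
        unfold Rdiv in Hur. rewrite Rmult_assoc, Rinv_l in Hur by lra. lra. }
      assert (HC : Rabs (PSeries c u) <= u * L1).
      { rewrite Ec, Rabs_mult, (Rabs_pos_eq u) by lra. apply Rmult_le_compat_l; lra. }
      assert (HuL : 0 <= u * L1) by nra.
      apply Rle_trans with (1 := HC).
      assert (Hs2 : sqrt (PSeries q u) ^ 2 = PSeries q u) by (apply pow2_sqrt; lra).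
      apply Rnot_lt_le. intros Hcon.
      assert ((sqrt (PSeries q u) / 8) ^ 2 < (u * L1) ^ 2) by (simpl; nra).
      assert (u * (u * (100 * L1 ^ 2)) <= u * kap) by (apply Rmult_le_compat_l; lra).
      nra.
    + assert (sg <= rs / 2) by apply Rmin_l. lra.
  - intros u v Huv Hv. destruct (Req_dec u v) as [->|Hne].
    { rewrite !Rminus_diag, Rabs_R0. lra. }
    assert (Hu' : 0 < u < eps) by lra. assert (Hv' : 0 < v < eps) by lra.
    destruct (Hsq u Hu') as [Hqu Hsu]. destruct (Hsq v Hv') as [Hqv Hsv].
    assert (Hin : forall x, u <= x <= v -> Rabs x < r).
    { intros x Hx. apply (Hev' x). lra. }
    assert (Hder : forall a, ps_conv r a -> forall x, u <= x <= v ->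
      is_derive (PSeries a) x (PSeries (PS_derive a) x)).
    { intros a [M HM] x Hx. apply is_derive_PSeries, (norm_le_inside r a M); auto. }
    destruct (derive_increment (PSeries c) (PSeries (PS_derive c)) u v) as (z1 & Hz1 & E1);
      [lra|now apply Hder|].
    destruct (derive_increment (PSeries q) (PSeries (PS_derive q)) u v) as (z2 & Hz2 & E2);
      [lra|now apply Hder|].
    destruct (Hev' z1 ltac:(lra)) as (_ & _ & _ & H1 & _).
    destruct (Hev' z2 ltac:(lra)) as (_ & _ & _ & _ & H2).
    rewrite E1, Rabs_mult, (Rabs_pos_eq (v - u)) by lra.
    apply Rle_trans with (L1 * (v - u)); [apply Rmult_le_compat_r; lra|].
    assert (Hu2 : sqrt (PSeries q u) ^ 2 = PSeries q u) by (apply pow2_sqrt; lra).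
    assert (Hv2 : sqrt (PSeries q v) ^ 2 = PSeries q v) by (apply pow2_sqrt; lra).
    set (su := sqrt (PSeries q u)) in *. set (sv := sqrt (PSeries q v)) in *.
    assert (Hprod : kap / 2 * (v - u) <= (sv - su) * (sv + su)).
    { replace ((sv - su) * (sv + su)) with (sv ^ 2 - su ^ 2) by ring.
      rewrite Hu2, Hv2, E2. apply Rmult_le_compat_r; lra. }
    assert (Hsum : (sv + su) * (2 * L1) <= kap).
    { assert (Hk : sg <= kap / (4 * L1)) by apply Rmin_r.
      apply (Rmult_le_compat_r (4 * L1)) in Hk; [|lra].
      unfold Rdiv in Hk. rewrite Rmult_assoc, Rinv_l in Hk by lra. nra. }
    assert (Hpos : 0 < (sv - su) * (sv + su)) by nra.
    assert (Hd : 0 < sv - su) by nra.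
    nra.
Qed.

Lemma regular_neighborhood rhobar w d om0 om1 W rho :
  0 < rho -> ps_conv rho d -> ps_conv rho W ->
  (forall n, (n < 3)%nat -> W n = 0) -> 0 < W 3%nat ->
  locally 0 (fun x => rhobar x = PSeries d x) ->
  locally 0 (fun x => w x = om0 - om1 * x + PSeries W x) ->
  exists r, 0 < r <= rho /\ forall x, Rabs x < r ->
    continuous rhobar x /\ rhobar x = PSeries d x /\ ex_derive w x /\
    w x = om0 - om1 * x + PSeries W x /\ 2 * W 3%nat * x ^ 2 <= Derive w x + om1.
Proof.
  intros Hrho Hd HW HW0 HW3 [e1 Erho] [e2 Ew].
  (* [W' = x ^ 2 * h] with [h 0 = 3 * W 3], so [2 * W 3] is a strict lower bound near 0. *)
  pose (h := PS_decr_1 (PS_decr_1 (PS_derive W))).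
  assert (Hh : forall x, PSeries (PS_derive W) x = x ^ 2 * PSeries h x).
  { intros x. rewrite PSeries_decr_1_aux.
    - rewrite PSeries_decr_1_aux; [unfold h; ring|].
      unfold PS_decr_1, PS_derive. rewrite HW0 by lia. ring.
    - unfold PS_derive. rewrite HW0 by lia. ring. }
  assert (Rh : Rbar_lt 0 (CV_radius h)).
  { unfold h. rewrite !CV_radius_decr_1, CV_radius_derive. now apply ps_conv_radius with rho. }
  destruct (locally_PSeries_gt h (2 * W 3%nat) Rh) as [e3 Eh].
  { unfold h, PS_decr_1, PS_derive. simpl INR. lra. }
  assert (H1 := cond_pos e1). assert (H2 := cond_pos e2). assert (H3 := cond_pos e3).
  exists (Rmin rho (Rmin e1 (Rmin e2 e3))).
  split; [split; [repeat apply Rmin_glb_lt; assumption|apply Rmin_l]|].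
  assert (M1 := Rmin_l rho (Rmin e1 (Rmin e2 e3))).
  assert (M2 := Rmin_r rho (Rmin e1 (Rmin e2 e3))).
  assert (M3 := Rmin_l e1 (Rmin e2 e3)). assert (M4 := Rmin_r e1 (Rmin e2 e3)).
  assert (M5 := Rmin_l e2 e3). assert (M6 := Rmin_r e2 e3).
  assert (Hball : forall x (e : posreal), Rabs x < e -> ball 0 e x).
  { intros x e Hx. apply Rabs_def2 in Hx.
    apply Rabs_def1; unfold minus, plus, opp; simpl; lra. }
  assert (Hloc : forall x (e : posreal) (T : R -> Prop), Rabs x < e ->
    (forall z, ball 0 e z -> T z) -> locally x T).
  { intros x e T Hx HT. assert (He : 0 < e - Rabs x) by lra.
    exists (mkposreal _ He). intros z Hz. apply HT, Hball.
    change (Rabs (z - x) < e - Rabs x) in Hz.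
    replace z with (x + (z - x)) by ring.
    apply Rle_lt_trans with (1 := Rabs_triang _ _). lra. }
  intros x Hx. assert (Hxr : Rabs x < rho) by lra.
  assert (Dw : is_derive w x (0 - om1 * 1 + PSeries (PS_derive W) x)).
  { apply is_derive_ext_loc with (fun x => om0 - om1 * x + PSeries W x).
    - apply (Hloc x e2); [lra|]. intros z Hz. symmetry. now apply Ew.
    - apply (is_derive_plus (V := R_NormedModule)).
      + apply (is_derive_minus (V := R_NormedModule)).
        * apply (is_derive_const (V := R_NormedModule)).
        * apply (is_derive_scal (fun x => x) x om1 1). apply (is_derive_id (K := R_AbsRing)).
      + destruct HW as [M HM]. now apply is_derive_PSeries, (norm_le_inside rho W M). }
  split; [|split; [|split; [|split]]].
  - apply continuous_ext_loc with (PSeries d).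
    + apply (Hloc x e1); [lra|]. intros z Hz. symmetry. now apply Erho.
    + now apply (ex_derive_continuous (V := R_NormedModule)), (ex_derive_ps_conv rho).
  - apply Erho, Hball. lra.
  - eexists; exact Dw.
  - apply Ew, Hball. lra.
  - rewrite (is_derive_unique _ _ _ Dw), Hh.
    assert (Hhx : 2 * W 3%nat < PSeries h x) by (apply Eh, Hball; lra).
    assert (0 <= x ^ 2) by apply pow2_ge_0. nra.
Qed.

Theorem theorem3p1 (rhobar w : R -> R) (rho_ om : nat -> R) (t0 : R)
    (hrho : expansion_at rhobar 0 (density_coef rho_))
    (hw : expansion_at w 0 (velocity_coef om))
    (hrho0 : 0 < rho_ 0%nat)
    (hom1 : 0 < om 1%nat)
    (hom3 : 0 < om 3%nat)
    (ht0 : t0 = 1 / om 1%nat) :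
  exists (delta r : R) (rho v : R -> R -> R) (x1 x2 y m : R -> R),
    0 < delta /\ 0 < r /\
    point_mass_solution rhobar w t0 delta r rho v x1 x2 y m /\
    analytic_on y t0 (t0 + delta) /\
    y t0 = t0 * om 0%nat /\
    exists Upsilon : R -> R,
      analytic_on Upsilon t0 (t0 + delta) /\
      0 < Upsilon t0 /\
      forall t : R, t0 < t <= t0 + delta ->
        m t = sqrt (t - t0) * Upsilon t.
Proof.
  set (d := density_coef rho_). set (W := ps_trunc 3 (velocity_coef om)).
  set (w1 := om 1%nat) in *.
  assert (HW0 : forall n, (n < 3)%nat -> W n = 0) by (intros; now apply ps_trunc_lt).
  assert (HW3 : 0 < W 3%nat).
  { unfold W. rewrite ps_trunc_ge by lia. apply Rdiv_lt_0_compat; [assumption|].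
    apply INR_fact_lt_0. }
  assert (Hd0 : 0 < d 0%nat).
  { apply Rdiv_lt_0_compat; [assumption|apply INR_fact_lt_0]. }
  destruct (expansion_radius _ _ _ hrho) as [Rd Erho].
  destruct (expansion_radius _ _ _ hw) as [Rw Ew].
  destruct (radius_ps_conv _ Rd) as (r1 & Hr1 & Cd).
  destruct (radius_ps_conv _ Rw) as (r2 & Hr2 & Cw).
  set (rho1 := Rmin r1 r2).
  assert (Hrho1 : 0 < rho1) by (now apply Rmin_glb_lt).
  apply (ps_conv_shrink _ rho1) in Cd; [|split; [lra|apply Rmin_l]].
  apply (ps_conv_shrink _ rho1) in Cw; [|split; [lra|apply Rmin_r]].
  assert (CW : ps_conv rho1 W).
  { destruct Cw as [M HM]. exists M. now apply norm_le_trunc. }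
  assert (Erho0 : locally 0 (fun x => rhobar x = PSeries d x)).
  { apply filter_imp with (2 := Erho). intros x. now rewrite Rminus_0_r. }
  assert (Ew0 : locally 0 (fun x => w x = om 0%nat - w1 * x + PSeries W x)).
  { apply filter_imp with (fun x => w x = PSeries (velocity_coef om) (x - 0) /\ Rabs x < rho1).
    - intros x [E Hx]. rewrite E, Rminus_0_r.
      unfold W, PSeries at 2.
      rewrite Series_trunc; [|lia|].
      + fold (PSeries (velocity_coef om) x). cbn [Init.Nat.pred sum_f_R0 velocity_coef].
        fold w1. ring.
      + apply ex_pseries_R. destruct Cw as [M HM]. eexists.
        apply norm_le_is_pseries with rho1 M; [lra|assumption].
    - apply filter_and; [assumption|]. exists (mkposreal _ Hrho1). intros x Hx.
      change (Rabs (x - 0) < rho1) in Hx. now rewrite Rminus_0_r in Hx. }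
  (* The primitives are bounded in norm only on a strictly smaller radius. *)
  set (rho0 := rho1 / 2). assert (Hrho0 : 0 < rho0 < rho1) by (unfold rho0; lra).
  assert (Cd' := ps_conv_shrink rho1 rho0 _ ltac:(lra) Cd).
  assert (CW' := ps_conv_shrink rho1 rho0 _ ltac:(lra) CW).
  assert (CG := ps_conv_Int rho1 rho0 d ltac:(lra) Cd).
  assert (Cm := ps_conv_mult _ _ _ Cd CW).
  assert (CP := ps_conv_Int rho1 rho0 _ ltac:(lra) Cm).
  assert (Cx := ps_conv_mult _ _ _ (ps_conv_var rho1 ltac:(lra)) Cd).
  assert (CQ := ps_conv_Int rho1 rho0 _ ltac:(lra) Cx).
  assert (HK : exists K, norm_le rho0 d K /\ norm_le rho0 W K /\ norm_le rho0 (PS_Int d) K /\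
    norm_le rho0 (PS_Int (PS_mult d W)) K /\ norm_le rho0 (PS_Int (PS_mult ps_var d)) K).
  { destruct Cd' as [M1 N1]. destruct CW' as [M2 N2]. destruct CG as [M3 N3].
    destruct CP as [M4 N4]. destruct CQ as [M5 N5].
    assert (P1 := norm_le_pos _ _ _ N1). assert (P2 := norm_le_pos _ _ _ N2).
    assert (P3 := norm_le_pos _ _ _ N3). assert (P4 := norm_le_pos _ _ _ N4).
    assert (P5 := norm_le_pos _ _ _ N5).
    exists (M1 + M2 + M3 + M4 + M5).
    repeat split; (eapply norm_le_mono; [|eassumption]); lra. }
  destruct HK as (K & Kd & KW & KG & KP & KQ).
  destruct (shock_profile d W w1 rho0 K)
    as (eta & r & c & q & A & B & M & Heta & Heta2 & Hr & Hc0 & Hq0 & Hq1 & HM0 &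
        Cc & Cq & CA & CB & CM & Hprof); auto; [lra|].
  set (G := PS_Int d) in *. set (P := PS_Int (PS_mult d W)) in *.
  set (Q := PS_Int (PS_mult ps_var d)) in *.
  destruct (regular_neighborhood rhobar w d (om 0%nat) w1 W rho0)
    as (rs & Hrs & Hreg); auto; [lra|].
  set (kap := w1 ^ 2 / W 3%nat).
  assert (Hkap : 0 < kap) by (apply Rdiv_lt_0_compat; [now apply pow_lt|assumption]).
  assert (Hq1' : q 1%nat = kap) by (rewrite Hq1; unfold kap, Rdiv; ring).
  destruct (admissible_times c q rs kap r) as (delta1 & Hdelta1 & Hadm & Hspread); auto; [lra|].
  assert (Rq1 : Rbar_lt 0 (CV_radius (PS_decr_1 q))).
  { rewrite CV_radius_decr_1. now apply ps_conv_radius with r. }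
  destruct (radius_ps_conv _ Rq1) as (r3 & Hr3 & [N3 HN3]).
  (* [b] is the analytic root of [q / u], whose value at 0 is [kap > 0]. *)
  destruct (ps_sqrt r3 (PS_decr_1 q) N3 Hr3 HN3) as (r4 & b & N4 & Hr4 & HN4 & Hb).
  { unfold PS_decr_1. now rewrite Hq1'. }
  set (ya := PS_mult (ps_add (ps_const t0) ps_var)
    (ps_add (ps_const (om 0%nat)) (ps_sub A (PS_mult B c)))).
  set (ua := ps_scal 2 (PS_mult b M)).
  assert (Hr' := Rlt_le _ _ Hr).
  assert (Cya : ps_conv r ya) by (unfold ya; conv).
  set (r5 := Rmin r4 r). assert (Hr5 : 0 < r5) by (apply Rmin_glb_lt; lra).
  assert (Cua : ps_conv r5 ua).
  { unfold ua. apply ps_conv_scal, ps_conv_mult.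
    - exists N4. apply norm_le_shrink with (2 := HN4). split; [lra|apply Rmin_l].
    - apply ps_conv_shrink with (2 := CM). split; [lra|apply Rmin_r]. }
  (* Strictly inside the open ranges, so that the final time [t0 + delta] is covered as well. *)
  set (delta := Rmin delta1 r5 / 2).
  assert (Hdelta : 0 < delta < Rmin delta1 r5).
  { assert (0 < Rmin delta1 r5) by (apply Rmin_glb_lt; lra). unfold delta; lra. }
  assert (Hm1 := Rmin_l delta1 r5). assert (Hm2 := Rmin_r delta1 r5).
  assert (Hm3 := Rmin_l r4 r). assert (Hm4 := Rmin_r r4 r). fold r5 in Hm3, Hm4.
  assert (Hqpos : forall u, 0 < u < delta1 -> 0 < PSeries q u).
  { intros u Hu. destruct (Hadm u Hu) as [H _]. apply Rlt_le_trans with (2 := H). nra. }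
  assert (Hpr : forall u, 0 < u < delta1 -> Rabs u < r /\ 0 <= sqrt (PSeries q u) /\
    PSeries q u = sqrt (PSeries q u) ^ 2).
  { intros u Hu. split; [apply Rabs_def1; lra|]. split; [apply sqrt_pos|].
    rewrite pow2_sqrt; [reflexivity|]. left; now apply Hqpos. }
  pose (y := fun t => PSeries ya (t - t0)).
  assert (Hy : forall x, Rabs x < r -> PSeries ya x =
    (t0 + x) * (om 0%nat + (PSeries A x - PSeries B x * PSeries c x))).
  { intros x Hx. unfold ya. eval_series r. reflexivity. }
  destruct (point_mass_of_profile rhobar w (PSeries G) (PSeries P) (PSeries Q) (PSeries W)
    (PSeries c) (PSeries q) (PSeries A) (PSeries B) y (om 0%nat) w1 (W 3%nat) t0 rs delta delta1)
    as (rho & v & Hsol); auto; try lra.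
  - intros x Hx. destruct (Hreg x Hx) as (_ & -> & _).
    apply (is_derive_PS_Int rho1); [assumption|lra].
  - intros x Hx. destruct (Hreg x Hx) as (_ & -> & _).
    rewrite <- (PSeries_ps_var x) at 2.
    rewrite <- (PSeries_conv_mult rho1); [|lra|apply ps_conv_var; lra|assumption].
    apply (is_derive_PS_Int rho1); [assumption|lra].
  - intros x Hx. destruct (Hreg x Hx) as (_ & -> & _).
    rewrite <- (PSeries_conv_mult rho1); [|lra|assumption|assumption].
    apply (is_derive_PS_Int rho1); [assumption|lra].
  - intros x Hx. apply (Hreg x Hx).
  - intros x Hx. apply (Hreg x Hx).
  - intros x Hx. apply (Hreg x Hx).
  - intros x Hx. apply (Hreg x Hx).
  - intros u Hu. apply (ex_derive_ps_conv r); [assumption|now apply Hpr].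
  - intros u Hu. apply (ex_derive_ps_conv r); [assumption|now apply Hpr].
  - intros u Hu. apply (Hadm u Hu).
  - intros u Hu. apply (Hadm u Hu).
  - intros u Hu. apply (Hadm u Hu).
  - intros u Hu. destruct (Hpr u Hu) as (H1 & H2 & H3). apply (Hprof u _ H1 H2 H3).
  - intros u Hu. destruct (Hpr u Hu) as (H1 & H2 & H3). apply (Hprof u _ H1 H2 H3).
  - intros u Hu. destruct (Hpr u Hu) as (H1 & H2 & H3). apply (Hprof u _ H1 H2 H3).
  - intros u Hu. destruct (Hpr u Hu) as (H1 & H2 & H3). apply (Hprof u _ H1 H2 H3).
  - intros t Ht. unfold y. rewrite Hy by (apply Rabs_def1; lra). ring.
  - intros t Ht. unfold y. apply (ex_derive_comp (PSeries ya) (fun t => t - t0)).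
    + apply (ex_derive_ps_conv r); [assumption|apply Rabs_def1; lra].
    + auto_derive. exact I.
  - exists delta, rs, rho, v. do 4 eexists.
    split; [lra|]. split; [lra|]. split; [exact Hsol|].
    split; [|split].
    + intros t Ht. destruct Cya as [N HN]. apply (PSeries_analytic r ya N); [assumption|].
      apply Rabs_def1; lra.
    + unfold y. rewrite Rminus_diag, Hy by (rewrite Rabs_R0; lra).
      (* At [u = 0] and [s = 0] the profile gives [A 0 = W 0 = 0]. *)
      destruct (Hprof 0 0) as (_ & _ & E & _).
      { rewrite Rabs_R0; lra. }
      { lra. }
      { rewrite PSeries_0, Hq0. ring. }
      rewrite Rplus_0_r, PSeries_0, Hc0, PSeries_0, HW0, Rmult_0_l, Rplus_0_r in E by lia.
      rewrite <- E, (PSeries_0 c), Hc0. ring.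
    + exists (fun t => PSeries ua (t - t0)).
      assert (Hua : forall x, Rabs x < r5 -> PSeries ua x = 2 * (PSeries b x * PSeries M x)).
      { intros x Hx. unfold ua. rewrite PSeries_ps_scal, (PSeries_conv_mult r5); auto.
        - exists N4. apply norm_le_shrink with (2 := HN4). split; [lra|apply Rmin_l].
        - apply ps_conv_shrink with (2 := CM). split; [lra|apply Rmin_r]. }
      split; [|split].
      * intros t Ht. destruct Cua as [N HN]. apply (PSeries_analytic r5 ua N); [assumption|].
        apply Rabs_def1; lra.
      * rewrite Rminus_diag, Hua by (rewrite Rabs_R0; lra).
        rewrite (PSeries_0 M), HM0.
        destruct (Hb 0) as [Hb0 _]; [rewrite Rabs_R0; lra|].
        assert (0 < PSeries b 0 * d 0%nat) by (now apply Rmult_lt_0_compat). lra.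
      * intros t Ht. assert (Hu : 0 < t - t0 < delta1) by lra.
        destruct (Hpr _ Hu) as (H1 & H2 & H3).
        destruct (Hprof _ _ H1 H2 H3) as (_ & _ & _ & _ & _ & E & _).
        rewrite E, Hua by (apply Rabs_def1; lra).
        destruct (Hb (t - t0)) as [Hb1 Hb2]; [apply Rabs_def1; lra|].
        rewrite (PSeries_decr_1_aux q), <- Hb2 by assumption.
        rewrite sqrt_mult, sqrt_pow2 by (lra || apply pow2_ge_0). ring.
Qed.
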